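(* Let $p \in \mathbb{R}$. There exists a polynomial $P_k(\cdot)$ of degree $k = 2([|p|]+1)$ such that the following holds: for every $x \in \mathbb{R}^d$, the translation operator $\tau_x : \mathcal{S}_p \to \mathcal{S}_p$ is a bounded linear map and $$\|\tau_x \varphi\|_p \le P_k(|x|)\, \|\varphi\|_p \quad \text{for all } \varphi \in \mathcal{S}_p .$$
   Context: $[\cdot]$ denotes the integer part. $\mathcal{S}=\mathcal{S}(\mathbb{R}^d)$ is the space of (real valued) rapidly decreasing smooth functions on $\mathbb{R}^d$ and $\mathcal{S}'$ is its dual, the space of tempered distributions. Hermite functions: for an integer $\ell\ge 0$ and $s\in\mathbb{R}$, $h_\ell(s) = (\sqrt{\pi}\,2^\ell \ell!)^{-1/2} e^{-s^2/2} H_\ell(s)$, where $H_\ell(s) = (-1)^\ell e^{s^2}\frac{d^\ell}{ds^\ell}e^{-s^2}$. For a multi-index $k=(k_1,\dots,k_d)\in\mathbb{Z}_+^d$ and $x=(x_1,\dots,x_d)$, $h_k(x)=h_{k_1}(x_1)\cdots h_{k_d}(x_d)$ and $|k|=k_1+\cdots+k_d$; $\{h_k\}$ is an orthonormal basis of $L^2(\mathbb{R}^d)$. For $p\in\mathbb{R}$, $\mathcal{S}_p$ is the Hilbert space obtained as the completion of $\mathcal{S}$ under the norm $\|\varphi\|_p^2=\sum_{k\in\mathbb{Z}_+^d}(2|k|+d)^{2p}\langle\varphi,h_k\rangle^2$, where $\langle\cdot,\cdot\rangle$ is the $L^2(\mathbb{R}^d)$ inner product. It is identified with the space of those $\varphi\in\mathcal{S}'$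 for which this sum (with $\langle\varphi,h_k\rangle$ the distributional pairing) is finite; the dual of $\mathcal{S}_p$ is $\mathcal{S}_{-p}$. Translations: for $x\in\mathbb{R}^d$, $\tau_x f(y)=f(y-x)$ on functions, and $\tau_x:\mathcal{S}'\to\mathcal{S}'$ is defined by $\langle\tau_x\varphi,f\rangle=\langle\varphi,\tau_{-x}f\rangle$ for $f\in\mathcal{S}$. *)

(* Defs.v *)
From HB Require Import structures.
From mathcomp Require Import all_boot all_order all_algebra.
From mathcomp Require Import all_classical all_reals all_analysis.
From mathcomp Require Import ring lra.

Set Implicit Arguments.
Unset Strict Implicit.
Unset Printing Implicit Defensive.
Import Order.TTheory GRing.Theory Num.Theory.
Import numFieldNormedType.Exports.
Local Open Scope classical_set_scope.
Local Open Scope ring_scope.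

(* The library norm [`|x|] on ['rV[R]_d] is the sup norm; it is used below only
   where equivalent norms are interchangeable.  The Euclidean norm: *)
Definition enorm (R : realType) (d : nat) (x : 'rV[R]_d) : R :=
  Num.sqrt (\sum_(i < d) x 0 i ^+ 2).

(* [partials [:: i1; ...; im] f] is d_{i1} ... d_{im} f.  On smooth functions
   it depends only on the multi-index of [s]; smoothness below quantifies over
   all orders of differentiation. *)
Definition partials (R : realType) (d : nat) (s : seq 'I_d)
    (f : 'rV[R]_d -> R) : 'rV[R]_d -> R :=
  foldr (fun i (g : 'rV[R]_d -> R) => 'D_(delta_mx 0 i : 'rV[R]_d) g) f s.

Definition smooth (R : realType) (d : nat) (f : 'rV[R]_d -> R) : Prop :=
  forall s : seq 'I_d, continuous (partials s f) /\
    forall i x, derivable (partials s f) x (delta_mx 0 i).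

Definition rapidly_decreasing (R : realType) (d : nat) (f : 'rV[R]_d -> R) :
    Prop :=
  forall (N : nat) (s : seq 'I_d), exists C : R, forall x,
    (1 + `|x|) ^+ N * `|partials s f x| <= C.

Definition schwartz_pred (R : realType) (d : nat) : {pred 'rV[R]_d -> R} :=
  [pred f | `[< smooth f /\ rapidly_decreasing f >]].

Record schwartz (R : realType) (d : nat) := Schwartz {
  schwartz_fun :> 'rV[R]_d -> R ;
  schwartzP : schwartz_fun \in @schwartz_pred R d }.

HB.instance Definition _ (R : realType) (d : nat) :=
  [isSub for @schwartz_fun R d].
HB.instance Definition _ (R : realType) (d : nat) :=
  [Choice of schwartz R d by <:].

Lemma partials_lin (R : realType) (d : nat) (s : seq 'I_d) (a : R)
    (f g : 'rV[R]_d -> R) : smooth f -> smooth g ->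
  partials s (a *: f + g) = a *: partials s f + partials s g.
Proof.
move=> sf sg; elim: s => [//|i s IH] /=.
rewrite IH; apply/funext => x.
have df := (sf s).2 i x; have dg := (sg s).2 i x.
by rewrite deriveD ?deriveZ//; exact: derivableZ.
Qed.

Lemma partials0 (R : realType) (d : nat) (s : seq 'I_d) :
  partials s (0 : 'rV[R]_d -> R) = 0.
Proof.
elim: s => [//|i s IH] /=; rewrite IH; apply/funext => x.
exact: (derive_cst (0 : R) x (delta_mx 0 i)).
Qed.

Lemma smooth0 (R : realType) (d : nat) : smooth (0 : 'rV[R]_d -> R).
Proof.
move=> s; rewrite partials0; split.
  exact: (fun x => @cst_continuous _ R (0 : R) x).
by move=> i x; exact: (derivable_cst (0 : R) x (delta_mx 0 i)).
Qed.

Lemma smooth_lin (R : realType) (d : nat) (a : R) (f g : 'rV[R]_d -> R) :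
  smooth f -> smooth g -> smooth (a *: f + g).
Proof.
move=> sf sg s; rewrite partials_lin//; split.
  move=> x; have cf := (sf s).1 x; have cg := (sg s).1 x.
  exact: (cvgD (@cvgZr _ R^o _ _ _ a _ _ cf) cg).
by move=> i x; apply: derivableD; [apply: derivableZ; exact: (sf s).2|
  exact: (sg s).2].
Qed.

Lemma weight_ge0 (R : realType) (d N : nat) (x : 'rV[R]_d) :
  0 <= (1 + `|x|) ^+ N.
Proof. by rewrite exprn_ge0// addr_ge0. Qed.

Lemma schwartz_submod_closed (R : realType) (d : nat) :
  submod_closed (@schwartz_pred R d).
Proof.
split.
  apply/asboolP; split; first exact: smooth0.
  by move=> N s; exists 0 => x; rewrite partials0 normr0 mulr0.
move=> a f g /asboolP[sf rf] /asboolP[sg rg]; apply/asboolP.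
split; first exact: smooth_lin.
move=> N s; have [C HC] := rf N s; have [D HD] := rg N s.
exists (`|a| * C + D) => x; rewrite partials_lin//.
apply: (@le_trans _ _ (`|a| * ((1 + `|x|) ^+ N * `|partials s f x|)
   + (1 + `|x|) ^+ N * `|partials s g x|)); last first.
  by rewrite lerD// ler_wpM2l.
rewrite mulrCA -mulrDr ler_wpM2l ?weight_ge0//.
by rewrite (le_trans (ler_normD _ _))// normrM.
Qed.

HB.instance Definition _ (R : realType) (d : nat) :=
  GRing.isSubmodClosed.Build _ _ (@schwartz_pred R d)
    (@schwartz_submod_closed R d).
HB.instance Definition _ (R : realType) (d : nat) :=
  [SubChoice_isSubLmodule of schwartz R d by <:].

Lemma schwartz_smooth (R : realType) (d : nat) (f : schwartz R d) : smooth f.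
Proof. by have := schwartzP f => /asboolP[]. Qed.

Lemma schwartz_decr (R : realType) (d : nat) (f : schwartz R d) :
  rapidly_decreasing f.
Proof. by have := schwartzP f => /asboolP[]. Qed.

(* The usual Frechet topology on S: a base of neighbourhoods of 0 is given by
   the seminorm balls sup_{x, |s| <= N} (1 + |x|)^N |d_s f(x)| <= e, e > 0. *)
Definition schwartz_ball (R : realType) (d N : nat) (e : R) :
    set (schwartz R d) :=
  [set f | forall s x, (size s <= N)%N ->
     (1 + `|x|) ^+ N * `|partials s f x| <= e].

Definition schwartz_nbhs (R : realType) (d : nat) (f : schwartz R d) :
    set_system (schwartz R d) :=
  filter_from [set Ne : nat * R | 0 < Ne.2]
    (fun Ne => [set g | schwartz_ball Ne.1 Ne.2 (g - f)]).

HB.instance Definition _ (R : realType) (d : nat) :=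
  hasNbhs.Build (schwartz R d) (@schwartz_nbhs R d).

Lemma schwartz_partialsD (R : realType) (d : nat) (f g : schwartz R d) s :
  partials s (f + g : schwartz R d) = partials s f + partials s g.
Proof.
rewrite -[f in LHS]scale1r -[in RHS](scale1r (partials s f)).
by rewrite -partials_lin//; exact: schwartz_smooth.
Qed.

Lemma schwartz_partialsZ (R : realType) (d : nat) a (f : schwartz R d) s :
  partials s (a *: f : schwartz R d) = a *: partials s f.
Proof.
rewrite -[in RHS](addr0 (a *: partials s f)) -(partials0 R s) -partials_lin.
- by rewrite addr0.
- exact: schwartz_smooth.
- exact: smooth0.
Qed.

Lemma schwartz_ballD (R : realType) (d N : nat) (e1 e2 : R)
    (f g : schwartz R d) :
  schwartz_ball N e1 f -> schwartz_ball N e2 g ->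
  schwartz_ball N (e1 + e2) (f + g).
Proof.
move=> Hf Hg s x sN; rewrite schwartz_partialsD.
rewrite (le_trans _ (lerD (Hf s x sN) (Hg s x sN)))//.
by rewrite -mulrDr ler_wpM2l ?weight_ge0// ler_normD.
Qed.

Lemma schwartz_ball_le (R : realType) (d N M : nat) (e1 e2 : R)
    (f : schwartz R d) : (N <= M)%N -> e1 <= e2 ->
  schwartz_ball M e1 f -> schwartz_ball N e2 f.
Proof.
move=> NM e12 Hf s x sN; rewrite (le_trans _ e12)//.
rewrite (le_trans _ (Hf s x (leq_trans sN NM)))// ler_wpM2r//.
by apply: ler_weXn2l => //; rewrite lerDl.
Qed.

Lemma schwartz_ball0 (R : realType) (d N : nat) (e : R) :
  0 <= e -> schwartz_ball N e (0 : schwartz R d).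
Proof. by move=> e0 s x _; rewrite (partials0 R s) normr0 mulr0. Qed.

Lemma schwartz_nbhs_filter (R : realType) (d : nat) (f : schwartz R d) :
  ProperFilter (nbhs f).
Proof.
apply: filter_from_proper; last first.
  by move=> [N e] /= e0; exists f; rewrite /= subrr; apply: schwartz_ball0;
    exact: ltW.
apply: filter_from_filter; first by exists (0%N, 1) => /=.
move=> [N e] [M e'] /= e0 e'0; exists (maxn N M, Num.min e e') => /=.
  by rewrite lt_min e0.
move=> g /= Hg; split.
  by apply: schwartz_ball_le Hg; [exact: leq_maxl|rewrite ge_min lexx].
by apply: schwartz_ball_le Hg; [exact: leq_maxr|rewrite ge_min lexx orbT].
Qed.

Lemma schwartz_nbhs_singleton (R : realType) (d : nat) (f : schwartz R d)
    (A : set (schwartz R d)) : nbhs f A -> A f.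
Proof.
move=> [[N e]/= e0]; apply => /=.
by rewrite subrr; apply: schwartz_ball0; exact: ltW.
Qed.

Lemma schwartz_nbhs_nbhs (R : realType) (d : nat) (f : schwartz R d)
    (A : set (schwartz R d)) : nbhs f A -> nbhs f (nbhs^~ A).
Proof.
move=> [[N e]/= e0 HA]; exists (N, e / 2) => /=; first by rewrite divr_gt0.
move=> g /= Hg; exists (N, e / 2) => /=; first by rewrite divr_gt0.
move=> h /= Hh; apply: HA => /=.
rewrite (splitr e) -[h - f](subrKA g); exact: schwartz_ballD.
Qed.

HB.instance Definition _ (R : realType) (d : nat) :=
  Nbhs_isNbhsTopological.Build (schwartz R d) (@schwartz_nbhs_filter R d)
    (@schwartz_nbhs_singleton R d) (@schwartz_nbhs_nbhs R d).

Definition tempered_pred (R : realType) (d : nat) : {pred schwartz R d -> R} :=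
  [pred u : schwartz R d -> R | `[< linear_for *%R u /\ continuous u >]].

(* S', the topological dual of S; the application [phi f] is the distributional
   pairing <phi, f>. *)
Record tempered (R : realType) (d : nat) := Tempered {
  tempered_fun :> schwartz R d -> R ;
  temperedP : tempered_fun \in @tempered_pred R d }.

HB.instance Definition _ (R : realType) (d : nat) :=
  [isSub for @tempered_fun R d].
HB.instance Definition _ (R : realType) (d : nat) :=
  [Choice of tempered R d by <:].

Lemma tempered_submod_closed (R : realType) (d : nat) :
  submod_closed (@tempered_pred R d).
Proof.
split.
  apply/asboolP; split; last exact: cst_continuous.
  by move=> a f g; change (0 = a * 0 + 0 :> R); rewrite mulr0 addr0.
move=> a u v /asboolP[lu cu] /asboolP[lv cv]; apply/asboolP.
split.
  move=> b f g.
  change (a * u (b *: f + g) + v (b *: f + g) =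
    b * (a * u f + v f) + (a * u g + v g)).
  rewrite lu lv.
  ring.
move=> f; exact: (cvgD (@cvgZr _ R^o _ _ _ a _ _ (cu f)) (cv f)).
Qed.

HB.instance Definition _ (R : realType) (d : nat) :=
  GRing.isSubmodClosed.Build _ _ (@tempered_pred R d)
    (@tempered_submod_closed R d).
HB.instance Definition _ (R : realType) (d : nat) :=
  [SubChoice_isSubLmodule of tempered R d by <:].

Lemma tempered_lin (R : realType) (d : nat) (u : tempered R d) :
  linear_for *%R u.
Proof. by have := temperedP u => /asboolP[]. Qed.

Lemma tempered_cont (R : realType) (d : nat) (u : tempered R d) :
  continuous u.
Proof. by have := temperedP u => /asboolP[]. Qed.

Definition translate_fun (R : realType) (d : nat) (x : 'rV[R]_d)
    (f : 'rV[R]_d -> R) : 'rV[R]_d -> R := fun y => f (y - x).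

Lemma partials_translate (R : realType) (d : nat) (s : seq 'I_d)
    (x : 'rV[R]_d) (f : 'rV[R]_d -> R) :
  partials s (translate_fun x f) = translate_fun x (partials s f).
Proof.
elim: s => [//|i s IH] /=; rewrite IH; apply/funext => y.
apply: (congr1 (fun F : R -> R => lim (F @ 0^'))).
by rewrite /translate_fun; apply/funext => h /=; rewrite addrA.
Qed.

Lemma weight_translate (R : realType) (d N : nat) (x y : 'rV[R]_d) (g : R) :
  (1 + `|y|) ^+ N * `|g| <=
  (1 + `|x|) ^+ N * ((1 + `|y - x|) ^+ N * `|g|).
Proof.
rewrite mulrA ler_wpM2r// -exprMn lerXn2r ?nnegrE ?mulr_ge0 ?addr_ge0//.
have := ler_normD (y - x) x; rewrite subrK => h.
have := normr_ge0 x; have := normr_ge0 (y - x).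
by nra.
Qed.

Lemma translate_schwartz (R : realType) (d : nat) (x : 'rV[R]_d)
    (f : schwartz R d) : translate_fun x f \in @schwartz_pred R d.
Proof.
apply/asboolP; split.
  move=> s; rewrite partials_translate; split.
    move=> y; have c1 : {for y, continuous (fun y : 'rV[R]_d => y - x)}.
      exact: (cvgB cvg_id (cvg_cst x)).
    exact: (continuous_comp c1 ((schwartz_smooth f s).1 (y - x))).
  move=> i y; have := (schwartz_smooth f s).2 i (y - x).
  rewrite /derivable; set F := (X in cvg (X @ _) -> _).
  set G := (X in _ -> cvg (X @ _)).
  suff -> : F = G by [].
  by apply/funext => h; rewrite /F /G /translate_fun /= addrA.
move=> N s; have [C HC] := schwartz_decr f N s.
exists ((1 + `|x|) ^+ N * C) => y; rewrite partials_translate.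
by rewrite (le_trans (weight_translate _ x _ _))// ler_wpM2l ?weight_ge0.
Qed.

Definition translateS (R : realType) (d : nat) (x : 'rV[R]_d)
    (f : schwartz R d) : schwartz R d := Schwartz (translate_schwartz x f).

Lemma translateS_lin (R : realType) (d : nat) (x : 'rV[R]_d) :
  linear (translateS x).
Proof. by move=> a f g; apply/val_inj. Qed.

HB.instance Definition _ (R : realType) (d : nat) (x : 'rV[R]_d) :=
  GRing.isLinear.Build R (schwartz R d) (schwartz R d) *:%R (translateS x)
    (translateS_lin x).

Lemma translateS_cont (R : realType) (d : nat) (x : 'rV[R]_d) :
  continuous (translateS x).
Proof.
move=> f A [[N e]/= e0 HA].
have w0 : 0 < (1 + `|x|) ^+ N by rewrite exprn_gt0// ltr_pwDl.
exists (N, e / (1 + `|x|) ^+ N) => /=; first by rewrite divr_gt0.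
move=> g /= Hg; apply: HA => /= s y sN.
rewrite -linearB /= partials_translate.
rewrite (le_trans (weight_translate _ x _ _))//.
by rewrite mulrC -ler_pdivlMr//; exact: Hg.
Qed.

Lemma translate_tempered (R : realType) (d : nat) (x : 'rV[R]_d)
    (u : tempered R d) : u \o translateS (- x) \in @tempered_pred R d.
Proof.
apply/asboolP; split.
  by move=> a f g; rewrite /= linearP tempered_lin.
move=> f; exact: (continuous_comp (@translateS_cont _ _ _ f)
  (@tempered_cont _ _ u _)).
Qed.

Definition translate (R : realType) (d : nat) (x : 'rV[R]_d)
    (u : tempered R d) : tempered R d := Tempered (translate_tempered x u).

Definition hermite_poly_fun (R : realType) (l : nat) (s : R) : R :=
  (- 1) ^+ l * expR (s ^+ 2) *
  (derive1n l (fun t : R => expR (- t ^+ 2))) s.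

Definition hermite1 (R : realType) (l : nat) (s : R) : R :=
  (Num.sqrt pi * 2 ^+ l * l`!%:R) `^ (- 2^-1) * expR (- s ^+ 2 / 2) *
  hermite_poly_fun l s.

Definition hermite_fun (R : realType) (d : nat) (k : {ffun 'I_d -> nat})
    (x : 'rV[R]_d) : R := \prod_(i < d) hermite1 (k i) (x 0 i).

(* Products of (polynomial) * (Gaussian) factors: a family containing the
   Hermite functions and stable under partial derivatives. *)
Definition pgauss1 (R : realType) (q : {poly R}) (t : R) : R :=
  q.[t] * expR (- t ^+ 2 / 2).

Definition pgauss (R : realType) (d : nat) (q : 'I_d -> {poly R})
    (x : 'rV[R]_d) : R := \prod_(i < d) pgauss1 (q i) (x 0 i).

Definition pgauss_step (R : realType) (d : nat) (j : 'I_d)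
    (q : 'I_d -> {poly R}) (i : 'I_d) : {poly R} :=
  if i == j then (q i)^`() - 'X * q i else q i.

Lemma is_derive_expR_sqr (R : realType) (c t : R) :
  is_derive t 1 (fun s : R => expR (- s ^+ 2 * c))
    (- (2 * c * t) * expR (- t ^+ 2 * c)).
Proof.
have E : (fun s : R => - s ^+ 2 * c) = horner (- (c *: 'X^2)).
  by apply/funext => s; rewrite hornerN hornerZ hornerXn mulNr mulrC.
have D : is_derive t 1 (fun s : R => - s ^+ 2 * c) (- (2 * c * t)).
  rewrite E; apply: is_derive_eq.
  by rewrite derivN derivZ derivXn hornerN hornerZ hornerMn hornerXn/=; ring.
rewrite mulrC; exact: (is_derive1_comp (is_derive_expR _) D).
Qed.

Lemma is_derive_pgaussc (R : realType) (q : {poly R}) (c t : R) :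
  is_derive t 1 (fun s : R => q.[s] * expR (- s ^+ 2 * c))
    ((q^`() - (2 * c) *: 'X * q).[t] * expR (- t ^+ 2 * c)).
Proof.
have H := @is_deriveM R R (horner q) (fun s : R => expR (- s ^+ 2 * c)) t 1
  _ _ (is_derive_poly q t) (is_derive_expR_sqr c t).
apply: is_derive_eq.
by rewrite !hornerE /GRing.scale/=; ring.
Qed.

Lemma is_derive_pgauss1 (R : realType) (q : {poly R}) (t : R) :
  is_derive t 1 (pgauss1 q) (pgauss1 (q^`() - 'X * q) t).
Proof.
have := is_derive_pgaussc q 2^-1 t.
by rewrite divff// scale1r.
Qed.

Lemma derive1n_gauss (R : realType) (l : nat) : exists q : {poly R},
  derive1n l (fun t : R => expR (- t ^+ 2)) =
  (fun t => q.[t] * expR (- t ^+ 2)).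
Proof.
elim: l => [|l [q IH]].
  by exists 1; apply/funext => t; rewrite hornerE mul1r.
exists (q^`() - (2 * 1) *: 'X * q); rewrite derive1nS IH.
have -> : (fun t : R => q.[t] * expR (- t ^+ 2)) =
    (fun t => q.[t] * expR (- t ^+ 2 * 1)).
  by apply/funext => t; rewrite mulr1.
apply/funext => t; rewrite derive1E.
have [_ ->] := is_derive_pgaussc q 1 t.
by congr (_ * expR _); rewrite mulr1.
Qed.

Lemma hermite1_pgauss1 (R : realType) (l : nat) : exists q : {poly R},
  hermite1 l = pgauss1 q.
Proof.
have [q Hq] := derive1n_gauss R l.
set c := (Num.sqrt (pi : R) * 2 ^+ l * l`!%:R) `^ (- 2^-1).
exists ((c * (- 1) ^+ l) *: q); apply/funext => s.
rewrite /hermite1 /hermite_poly_fun Hq /pgauss1 hornerZ -/c.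
have E : expR (s ^+ 2) * expR (- s ^+ 2) = 1 by rewrite -expRD subrr expR0.
rewrite -[RHS]mulr1 -E; ring.
Qed.

Lemma hermite_pgauss (R : realType) (d : nat) (k : {ffun 'I_d -> nat}) :
  exists q : 'I_d -> {poly R}, hermite_fun k = pgauss q.
Proof.
have [q Hq] := choice (fun i : 'I_d => hermite1_pgauss1 R (k i)).
exists q; apply/funext => x; rewrite /hermite_fun /pgauss.
by apply: eq_bigr => i _; rewrite Hq.
Qed.

Lemma continuous_pgauss (R : realType) (d : nat) (q : 'I_d -> {poly R}) :
  continuous (pgauss q).
Proof.
rewrite /pgauss; elim: (index_enum _) => [|i r IH].
  by under eq_fun do rewrite big_nil; exact: cst_continuous.
under eq_fun do rewrite big_cons.
move=> x.
have c1 : {for x 0 i, continuous (pgauss1 (q i))}.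
  apply/differentiable_continuous/derivable1_diffP.
  by have [] := is_derive_pgauss1 (q i) (x 0 i).
exact: (cvgM (continuous_comp (@coord_continuous R 1 d 0 i x) c1) (IH x)).
Qed.

Lemma is_derive_pgauss (R : realType) (d : nat) (q : 'I_d -> {poly R})
    (j : 'I_d) (x : 'rV[R]_d) :
  is_derive x (delta_mx 0 j : 'rV[R]_d) (pgauss q) (pgauss (pgauss_step j q) x).
Proof.
set K := \prod_(i < d | i != j) pgauss1 (q i) (x 0 i).
have -> : pgauss (pgauss_step j q) x =
    K * pgauss1 ((q j)^`() - 'X * q j) (x 0 j).
  rewrite /pgauss (bigD1 j)//= /pgauss_step eqxx mulrC; congr (_ * _).
  by apply: eq_bigr => i /negbTE ->.
have pE (y : 'rV[R]_d) : pgauss q y =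
    pgauss1 (q j) (y 0 j) * \prod_(i < d | i != j) pgauss1 (q i) (y 0 i).
  by rewrite /pgauss (bigD1 j).
have [D1 D2] := is_derive_pgauss1 (q j) (x 0 j).
pose F h := h^-1 *: ((pgauss1 (q j) \o shift (x 0 j)) (h *: (1 : R))
  - pgauss1 (q j) (x 0 j)).
have EF : (fun h : R => h^-1 *: ((pgauss q \o shift x)
    (h *: (delta_mx 0 j : 'rV[R]_d)) - pgauss q x)) = (fun h => K * F h).
  apply/funext => h; rewrite /F /= !pE.
  rewrite (eq_bigr (fun i => pgauss1 (q i) (x 0 i))); last first.
    by move=> i ij; rewrite !mxE eqxx (negbTE ij) mulr0 add0r.
  rewrite !mxE !eqxx -/K /GRing.scale/= !mulr1.
  by ring.
have cF : F h @[h --> 0^'] --> pgauss1 ((q j)^`() - 'X * q j) (x 0 j).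
  by rewrite -D2; exact: D1.
have cKF : K * F h @[h --> 0^'] --> K * pgauss1 ((q j)^`() - 'X * q j) (x 0 j).
  by apply: cvgM => //; exact: cvg_cst.
split; first by rewrite /derivable EF; apply/cvg_ex; eexists; exact: cKF.
by rewrite /derive EF; apply: cvg_lim cKF.
Qed.

Lemma partials_pgauss (R : realType) (d : nat) (s : seq 'I_d)
    (q : 'I_d -> {poly R}) : exists q' : 'I_d -> {poly R},
  partials s (pgauss q) = pgauss q'.
Proof.
elim: s => [|i s [q' IH]] /=; first by exists q.
exists (pgauss_step i q'); rewrite IH; apply/funext => x.
by have [] := is_derive_pgauss q' i x.
Qed.

Lemma pgauss1_bound (R : realType) (N : nat) (q : {poly R}) :
  exists C : R, forall t, (1 + `|t|) ^+ N * `|pgauss1 q t| <= C.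
Proof.
pose M := (N + size q)%N; pose S := \sum_(i < size q) `|q`_i|.
have S0 : 0 <= S by exact: sumr_ge0.
exists (S * expR (M%:R ^+ 2 / 2)) => t.
have t1 : 1 <= 1 + `|t| by rewrite lerDl.
have qt : `|q.[t]| <= S * (1 + `|t|) ^+ size q.
  rewrite horner_coef (le_trans (ler_norm_sum _ _ _))// mulr_suml.
  apply: ler_sum => i _; rewrite normrM ler_wpM2l// normrX.
  apply: (@le_trans _ _ ((1 + `|t|) ^+ i)).
    by rewrite lerXn2r ?nnegrE ?addr_ge0// lerDr.
  by apply: ler_weXn2l => //; exact: ltnW.
rewrite /pgauss1 normrM (ger0_norm (expR_ge0 _)).
apply: (@le_trans _ _ (S * ((1 + `|t|) ^+ M * expR (- t ^+ 2 / 2)))).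
  rewrite exprD [leRHS](_ : _ = (1 + `|t|) ^+ N *
    ((S * (1 + `|t|) ^+ size q) * expR (- t ^+ 2 / 2))); last by ring.
  by rewrite ler_wpM2l ?exprn_ge0 ?addr_ge0// ler_wpM2r ?expR_ge0.
rewrite ler_wpM2l//.
apply: (@le_trans _ _ (expR `|t| ^+ M * expR (- t ^+ 2 / 2))).
  rewrite ler_wpM2r ?expR_ge0// lerXn2r ?nnegrE ?addr_ge0 ?expR_ge0//.
  exact: expR_ge1Dx.
rewrite -expRM_natl -expRD ler_expR -(real_normK (num_real t)).
have := sqr_ge0 (M%:R - `|t|); rewrite sqrrB; lra.
Qed.

Lemma rapidly_decreasing_pgauss (R : realType) (d : nat)
    (q : 'I_d -> {poly R}) : rapidly_decreasing (pgauss q).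
Proof.
move=> N s; have [{}q ->] := partials_pgauss s q.
have [C HC] := choice (fun i => pgauss1_bound N (q i)).
exists (\prod_(i < d) C i) => x.
apply: (@le_trans _ _ (\prod_(i < d)
    ((1 + `|x 0 i|) ^+ N * `|pgauss1 (q i) (x 0 i)|))); last first.
  apply: ler_prod => i _; by rewrite HC andbT mulr_ge0 ?exprn_ge0 ?addr_ge0.
rewrite big_split/= /pgauss normr_prod ler_wpM2r ?prodr_ge0//.
rewrite prodrXl lerXn2r ?nnegrE ?addr_ge0 ?prodr_ge0//.
have ge1 (P : pred 'I_d) : 1 <= \prod_(i < d | P i) (1 + `|x 0 i|).
  elim/big_ind: _ => // [a b|i _]; last by rewrite lerDl.
  exact: mulr_ege1.
have [->|] := eqVneq `|x| 0; first by rewrite addr0.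
move=> /mx_norm_neq0[[i j] /=]; rewrite ord1 => Ej.
rewrite [`|x|]Ej (bigD1 j)//=.
by rewrite ler_peMr ?addr_ge0.
Qed.

Lemma hermite_schwartz (R : realType) (d : nat) (k : {ffun 'I_d -> nat}) :
  @hermite_fun R d k \in @schwartz_pred R d.
Proof.
have [q ->] := hermite_pgauss R k.
apply/asboolP; split; last exact: rapidly_decreasing_pgauss.
move=> s; have [q' ->] := partials_pgauss s q.
split; first exact: continuous_pgauss.
by move=> i x; have [] := is_derive_pgauss q' i x.
Qed.

Definition hermite (R : realType) (d : nat) (k : {ffun 'I_d -> nat}) :
  schwartz R d := Schwartz (hermite_schwartz R k).

Definition hs_weight (R : realType) (d : nat) (p : R)
    (k : {ffun 'I_d -> nat}) : R :=
  (2 * (\sum_(i < d) k i) + d)%N%:R `^ (2 * p).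

(* The square of the p-norm, possibly +oo. *)
Definition hs_sum (R : realType) (d : nat) (p : R) (phi : tempered R d) :
    \bar R :=
  (\esum_(k in [set: {ffun 'I_d -> nat}])
    (hs_weight p k * phi (hermite R k) ^+ 2)%:E)%E.

Definition hs_pred (R : realType) (d : nat) (p : R) : {pred tempered R d} :=
  [pred phi | (hs_sum p phi < +oo)%E].

(* S_p, as the space of tempered distributions with finite p-norm. *)
Record hermite_sobolev (R : realType) (d : nat) (p : R) := HermiteSobolev {
  hs_dist :> tempered R d ;
  hsP : hs_dist \in @hs_pred R d p }.

HB.instance Definition _ (R : realType) (d : nat) (p : R) :=
  [isSub for @hs_dist R d p].
HB.instance Definition _ (R : realType) (d : nat) (p : R) :=
  [Choice of hermite_sobolev d p by <:].

Lemma hs_submod_closed (R : realType) (d : nat) (p : R) :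
  submod_closed (@hs_pred R d p).
Proof.
have w0 (k : {ffun 'I_d -> nat}) : 0 <= hs_weight p k by exact: powR_ge0.
split.
  rewrite inE /hs_sum esum1// => k _.
  by rewrite (_ : (0 : tempered R d) (hermite R k) = 0)// expr0n mulr0.
move=> a u v; rewrite !inE => hu hv.
pose F (f : tempered R d) (k : {ffun 'I_d -> nat}) : R :=
  hs_weight p k * f (hermite R k) ^+ 2.
have F0 f k : 0 <= F f k by rewrite mulr_ge0 ?sqr_ge0.
have hc (c : R) (f : tempered R d) : 0 <= c -> (hs_sum p f < +oo)%E ->
    (\esum_(k in [set: {ffun 'I_d -> nat}]) (c * F f k)%:E < +oo)%E.
  move=> c0 hf; apply: (@le_lt_trans _ _ (c%:E * hs_sum p f)%E).
    apply: ub_ereal_sup => _ [A [fA _] <-].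
    under eq_fsbigr do rewrite EFinM.
    rewrite -ge0_mule_fsumr; last by move=> k; rewrite lee_fin.
    apply: lee_wpmul2l; first by rewrite lee_fin.
    by apply: ereal_sup_ubound; exists A.
  by rewrite lte_mul_pinfty ?lee_fin.
have : (\esum_(k in [set: {ffun 'I_d -> nat}])
  ((2 * a ^+ 2 * F u k)%:E + (2 * F v k)%:E) < +oo)%E.
  rewrite esumD; last 2 first.
  - by move=> k _; rewrite lee_fin mulr_ge0// mulr_ge0 ?sqr_ge0.
  - by move=> k _; rewrite lee_fin mulr_ge0.
  by rewrite lte_add_pinfty// hc// mulr_ge0 ?sqr_ge0.
apply: le_lt_trans; apply: le_esum => k _.
rewrite -EFinD lee_fin /F.
rewrite (_ : (a *: u + v) (hermite R k) =
   a * u (hermite R k) + v (hermite R k)) //.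
set x := u _; set y := v _; have := w0 k; move: (hs_weight p k) => w w_ge0.
have -> : 2 * a ^+ 2 * (w * x ^+ 2) + 2 * (w * y ^+ 2) =
  w * (2 * a ^+ 2 * x ^+ 2 + 2 * y ^+ 2) by ring.
rewrite ler_wpM2l//.
by have := sqr_ge0 (a * x - y); nra.
Qed.

HB.instance Definition _ (R : realType) (d : nat) (p : R) :=
  GRing.isSubmodClosed.Build _ _ (@hs_pred R d p) (@hs_submod_closed R d p).
HB.instance Definition _ (R : realType) (d : nat) (p : R) :=
  [SubChoice_isSubLmodule of hermite_sobolev d p by <:].

Definition hs_norm (R : realType) (d : nat) (p : R)
    (phi : hermite_sobolev d p) : R := Num.sqrt (fine (hs_sum p phi)).

(* Main.v *)
Require Import Defs.
From HB Require Import structures.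
From mathcomp Require Import all_boot all_order all_algebra.
From mathcomp Require Import all_classical all_reals all_analysis.
From mathcomp Require Import ring lra zify.

Set Implicit Arguments.
Unset Strict Implicit.
Unset Printing Implicit Defensive.
Import Order.TTheory GRing.Theory Num.Theory.
Import numFieldNormedType.Exports.
Local Open Scope classical_set_scope.
Local Open Scope ring_scope.

(** The proof is an energy estimate along the segment t |-> t x, carried out on
    Hermite coefficients.

    Put a_k(t) = <tau_(tx) phi, h_k>. The ladder relation
      d_i h_k = sqrt(k_i/2) h_(k-e_i) - sqrt((k_i+1)/2) h_(k+e_i)
    turns translation into the infinite linear system
      a_k' = sum_i x_i (sqrt(k_i/2) a_(k-e_i) - sqrt((k_i+1)/2) a_(k+e_i))
    ([is_derive_translate_coef]), whose matrix is skew-symmetric. Hence the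
    derivative of sum_k W_k a_k^2 only sees the differences W_(k+e_i) - W_k
    along edges of the lattice, besides the time derivative of W.

    With r_k = sqrt(2|k| + d), the squared p-norm is sum_k r_k^(4p) a_k^2.
    In phase space h_k lives at distance about r_k from the origin and a
    the flow moves points at speed |x|, so r_k is replaced by r_k + s(t),
    where s is affine with slope +-c and c is a constant multiple of |x|. The
    sign is chosen so that (r_k + s(t))^(4p) decreases in time: s goes from 0
    to c when p < 0 and from c to 0 when p >= 0. The decrease then pays for the
    differences along edges, since sqrt(k_i+1) |r_(k+e_i) - r_k| is bounded.
    Comparing with r_k^(4p) at both ends costs the factor (1 + c)^(4|p|),
    because r <= r + c <= (1 + c) r for r >= 1. Taking square roots and rounding the
    exponent 2|p| up gives the polynomial (1 + b X)^(2([|p|]+1)), c = b|x|.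

    Two points make this rigorous for an arbitrary tempered distribution.
    The energy has to be truncated to |k| <= n, and the flux through |k| = n
    must vanish as n grows. The a_k grow polynomially in k
    ([translate_coef_growth]): phi is bounded by finitely many seminorms, and
    those of h_k grow polynomially, which reduces to a sup bound for
    one-dimensional Hermite functions obtained from the Sonin function of their
    differential equation ([sonin_bound]). Multiplying the weight by
    ((r_k + ct + A)/A)^(-M), with M large, absorbs this growth; the factor also
    decreases in time, costs the same constants as soon as A >= M, and tends to
    1 as A -> oo. *)

(** * Hermite polynomials and ladder relations in one variable *)

Fixpoint hermite_poly (R : realType) (l : nat) : {poly R} :=
  if l is l'.+1 then 2 *: ('X * hermite_poly R l') - (hermite_poly R l')^`() else 1.

Lemma hermite_polyS (R : realType) (l : nat) :
  hermite_poly R l.+1 = 2 *: ('X * hermite_poly R l) - (hermite_poly R l)^`().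
Proof. by []. Qed.

(** The Rodrigues formula satisfies the recursion H' = 2 s H - dH/ds, because
    d/ds (H exp(-s^2)) = (dH/ds - 2 s H) exp(-s^2). *)
Lemma hermite_poly_funE (R : realType) (l : nat) (s : R) :
  hermite_poly_fun l s = (hermite_poly R l).[s].
Proof.
have H : derive1n l (fun t : R => expR (- t ^+ 2)) =
    (fun t => ((-1) ^+ l *: hermite_poly R l).[t] * expR (- t ^+ 2 * 1)).
  elim: l => [|l IH].
    by apply/funext => t; rewrite /= expr0 scale1r hornerE mul1r mulr1.
  rewrite derive1nS IH; apply/funext => t; rewrite derive1E.
  have [_ ->] := is_derive_pgaussc ((-1) ^+ l *: hermite_poly R l) 1 t.
  congr (_ * _); rewrite hermite_polyS !derivZ !hornerE exprS /=; ring.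
rewrite /hermite_poly_fun H mulr1 hornerZ.
have E : expR (s ^+ 2) * expR (- s ^+ 2) = 1 by rewrite -expRD subrr expR0.
have E2 : (-1) ^+ l * (-1) ^+ l = 1 :> R by rewrite -exprMn mulrNN mulr1 expr1n.
transitivity (((-1) ^+ l * (-1) ^+ l) * (expR (s ^+ 2) * expR (- s ^+ 2)) *
  (hermite_poly R l).[s]); first by ring.
by rewrite E E2 !mul1r.
Qed.

Lemma deriv_hermite_poly (R : realType) (l : nat) :
  (hermite_poly R l)^`() = (2 * l%:R) *: hermite_poly R l.-1.
Proof.
elim: l => [|l IH]; first by rewrite /= mulr0 scale0r derivC.
rewrite hermite_polyS derivB derivZ derivM derivX mul1r IH derivZ /=.
case: l IH => [|l] IH; first by rewrite /= mulr0 !scale0r !(mulr0, addr0, subr0, mulr1).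
rewrite /= -/(hermite_poly R l) -[(2 *: ('X * hermite_poly R l) - _)]/(hermite_poly R l.+1).
have -> : (hermite_poly R l)^`() = 2 *: ('X * hermite_poly R l) - hermite_poly R l.+1.
  by rewrite hermite_polyS opprB addrC subrK.
rewrite -!mul_polyC !rmorphM/= -!natr1 !rmorphD /= rmorph1; ring.
Qed.

Definition hermite_cst (R : realType) (l : nat) : R :=
  (Num.sqrt pi * 2 ^+ l * l`!%:R) `^ (- 2^-1).

Lemma hermite_cst_rec (R : realType) (l : nat) :
  hermite_cst R l = Num.sqrt (2 * l.+1%:R) * hermite_cst R l.+1.
Proof.
have pi0 : 0 < Num.sqrt (pi : R) by rewrite sqrtr_gt0 pi_gt0.
have a0 : 0 < Num.sqrt (pi : R) * 2 ^+ l * l`!%:R.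
  by rewrite !mulr_gt0 ?exprn_gt0// ltr0n fact_gt0.
have b0 : 0 < 2 * l.+1%:R :> R by rewrite mulr_gt0.
rewrite /hermite_cst factS natrM.
have -> : Num.sqrt pi * 2 ^+ l.+1 * (l.+1%:R * l`!%:R) =
  (2 * l.+1%:R) * (Num.sqrt (pi : R) * 2 ^+ l * l`!%:R) by rewrite exprS; ring.
rewrite [in RHS]powRM ?ltW// [RHS]mulrA -(powR12_sqrt (ltW b0)).
by rewrite -powRD ?subrr ?powRr0 ?mul1r//; apply/implyP => _; rewrite gt_eqF.
Qed.

(** The polynomial factor of the normalised Hermite function: h_l is
    [pgauss1 (nhermite R l)]. *)
Definition nhermite (R : realType) (l : nat) : {poly R} := hermite_cst R l *: hermite_poly R l.

Lemma hermite1E (R : realType) (l : nat) : @hermite1 R l = pgauss1 (nhermite R l).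
Proof.
apply/funext => s; rewrite /hermite1 hermite_poly_funE /pgauss1 hornerZ.
by rewrite -/(hermite_cst R l) mulrAC.
Qed.

(** Matrix coefficient of d/ds and of multiplication by s between h_(l-1) and
    h_l. It vanishes at l = 0, so no case distinction is needed in the relations
    below although l.-1 is 0 there. *)
Definition ladder (R : realType) (l : nat) : R := Num.sqrt (l%:R / 2).

Lemma ladder0 (R : realType) : ladder R 0 = 0.
Proof. by rewrite /ladder mul0r sqrtr0. Qed.

Lemma ladder_ge0 (R : realType) l : 0 <= ladder R l.
Proof. exact: sqrtr_ge0. Qed.

Lemma sqr_ladder (R : realType) l : ladder R l ^+ 2 = l%:R / 2.
Proof. by rewrite sqr_sqrtr// divr_ge0. Qed.

Lemma hermite_cst_ladder (R : realType) (l : nat) :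
  hermite_cst R l = 2 * ladder R l.+1 * hermite_cst R l.+1.
Proof.
rewrite hermite_cst_rec; congr (_ * _).
have -> : 2 * l.+1%:R = 2 ^+ 2 * (l.+1%:R / 2) :> R by field.
by rewrite sqrtrM ?exprn_ge0// sqrtr_sqr ger0_norm.
Qed.

Lemma deriv_nhermite (R : realType) (l : nat) :
  (nhermite R l)^`() = (2 * ladder R l) *: nhermite R l.-1.
Proof.
rewrite /nhermite derivZ deriv_hermite_poly !scalerA; congr (_ *: _).
case: l => [|l]; first by rewrite ladder0 !(mulr0,mul0r).
rewrite /= (hermite_cst_ladder R l).
have := sqr_ladder R l.+1; set a := ladder _ _ => aE.
have -> : l.+1%:R = 2 * a ^+ 2 by rewrite aE; field.
ring.
Qed.

Lemma mulX_nhermite (R : realType) (l : nat) :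
  'X * nhermite R l = ladder R l *: nhermite R l.-1 + ladder R l.+1 *: nhermite R l.+1.
Proof.
have H : 2 *: ('X * nhermite R l) =
    (2 * ladder R l) *: nhermite R l.-1 + (2 * ladder R l.+1) *: nhermite R l.+1.
  rewrite -deriv_nhermite /nhermite derivZ scalerA -hermite_cst_ladder.
  rewrite hermite_polyS -scalerAr -scalerDr.
  by rewrite addrC subrK !scalerA mulrC.
have := congr1 (fun q => 2^-1 *: q) H; rewrite /= scalerDr !scalerA.
by rewrite !mulrA mulVf// !mul1r scale1r.
Qed.

(** The left-hand side is the polynomial factor of the derivative of h_l, so this
    is h_l' = sqrt(l/2) h_(l-1) - sqrt((l+1)/2) h_(l+1). *)
Lemma dgauss_nhermite (R : realType) (l : nat) :
  (nhermite R l)^`() - 'X * nhermite R l =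
    ladder R l *: nhermite R l.-1 - ladder R l.+1 *: nhermite R l.+1.
Proof.
rewrite deriv_nhermite mulX_nhermite opprD addrA -scalerBl; congr (_ *: _ - _).
by ring.
Qed.

Lemma deriv2_nhermite (R : realType) (l : nat) :
  ((nhermite R l)^`())^`() = 2 *: ('X * (nhermite R l)^`()) - (2 * l%:R) *: nhermite R l.
Proof.
rewrite deriv_nhermite derivZ deriv_nhermite.
case: l => [|l]; first by rewrite ladder0 !(mulr0, scale0r, scaler0) subr0.
rewrite [l.+1.-1]/= -[in RHS]scalerAr mulX_nhermite.
move: (nhermite R l.-1) (nhermite R l) (nhermite R l.+1) => u v w.
have := sqr_ladder R l.+1; set a := ladder _ l.+1 => aE.
have -> : l.+1%:R = 2 * a ^+ 2 by rewrite aE; field.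
rewrite -!mul_polyC !rmorphM/=; ring.
Qed.

(** h_l'' = (s^2 - (2l+1)) h_l: h_l is an eigenfunction of the harmonic
    oscillator. *)
Lemma hermite_equation (R : realType) (l : nat) (q := nhermite R l)
    (q1 := q^`() - 'X * q) (s : R) :
  pgauss1 (q1^`() - 'X * q1) s = (s ^+ 2 - (2 * l%:R + 1)) * pgauss1 q s.
Proof.
rewrite /q1 /pgauss1 derivB derivM derivX deriv2_nhermite -/q.
rewrite !hornerE /=; ring.
Qed.
(** * Sup bound for one-dimensional Hermite functions *)

Lemma is_derive_MVT (R : realType) (f df : R -> R) (a b : R) : a <= b ->
  (forall s, a <= s <= b -> is_derive s 1 f (df s)) ->
  exists2 c, a <= c <= b & f b - f a = df c * (b - a).
Proof.
move=> ab D; have [c cab E] := @MVT_segment R f df a b ab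
  (fun s (sab : s \in `]a, b[) => D s (subset_itv_oo_cc sab))
  (derivable_within_continuous
    (fun s (sab : s \in `[a, b]) => @ex_derive _ _ _ _ _ _ _ (D s sab))).
by exists c.
Qed.

(** The Sonin function F = y'^2 + (lam - s^2) y^2 satisfies F' = -2 s y^2, so it
    decreases on [0, oo) and bounds y' on the oscillatory region s^2 <= lam.
    Beyond sqrt(lam), y y' is nondecreasing; were it ever positive, y^2 would grow
    linearly, against the a priori bound C. Hence y^2 is nonincreasing there. *)
Lemma sonin_bound (R : realType) (y y1 : R -> R) (lam C : R) :
  0 <= lam ->
  (forall s : R, is_derive s 1 y (y1 s)) ->
  (forall s : R, is_derive s 1 y1 ((s ^+ 2 - lam) * y s)) ->
  (forall s, `|y s| <= C) ->
  forall s, 0 <= s -> `|y s| <= `|y 0| +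
    Num.sqrt lam * Num.sqrt (y1 0 ^+ 2 + lam * y 0 ^+ 2).
Proof.
move=> lam0 Dy Dy1 HC.
set F0 := _ + lam * _; set z := Num.sqrt lam.
have z0 : 0 <= z by exact: sqrtr_ge0.
have zE : z ^+ 2 = lam by rewrite sqr_sqrtr.
have F0_ge0 : 0 <= F0 := addr_ge0 (sqr_ge0 _) (mulr_ge0 lam0 (sqr_ge0 _)).
pose F s := y1 s ^+ 2 + (lam - s ^+ 2) * y s ^+ 2.
have DF (s : R) : is_derive s 1 F (- 2 * s * y s ^+ 2).
  apply: is_derive_eq.
  by rewrite /GRing.scale /=; ring.
have FF s : 0 <= s -> F s <= F0.
  move=> s0; have [c /andP[c0 _] E] := is_derive_MVT s0 (fun t _ => DF t).
  have -> : F0 = F 0 by rewrite /F /F0; ring.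
  rewrite -subr_le0 E !mulNr oppr_le0 subr0.
  by apply: mulr_ge0 => //; apply: mulr_ge0 (sqr_ge0 _); exact: mulr_ge0.
have low s : 0 <= s -> s <= z -> `|y s| <= `|y 0| + z * Num.sqrt F0.
  move=> s0 sz; have [c /andP[c0 cs] E] := is_derive_MVT s0 (fun t _ => Dy t).
  have -> : y s = y 0 + y1 c * s by move: E; rewrite subr0 => <-; ring.
  rewrite (le_trans (ler_normD _ _))// lerD2l normrM mulrC (ger0_norm s0).
  apply: ler_pM => //.
  rewrite -sqrtr_sqr ler_sqrt//; apply: le_trans (FF c c0).
  rewrite lerDl; apply: mulr_ge0 (sqr_ge0 _); rewrite subr_ge0 -zE lerXn2r ?nnegrE//.
  exact: le_trans sz.
have u_le0 s : z <= s -> y s * y1 s <= 0.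
  move=> zs; rewrite leNgt; apply/negP => us.
  have Du (t : R) : is_derive t 1 (fun t => y t * y1 t)
      (y1 t ^+ 2 + (t ^+ 2 - lam) * y t ^+ 2).
    by apply: is_derive_eq; rewrite /GRing.scale /=; ring.
  have Dy2 (t : R) : is_derive t 1 (fun t => y t ^+ 2) (2 * (y t * y1 t)).
    by apply: is_derive_eq; rewrite /GRing.scale /=; ring.
  have umono t : s <= t -> y s * y1 s <= y t * y1 t.
    move=> st; have [c /andP[sc _] E] := is_derive_MVT st (fun t _ => Du t).
    rewrite -subr_ge0 E mulr_ge0 ?subr_ge0//.
    apply: addr_ge0 (sqr_ge0 _) _; apply: mulr_ge0 (sqr_ge0 _).
    rewrite subr_ge0 -zE lerXn2r ?nnegrE//.
      by rewrite (le_trans z0)// (le_trans zs).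
    exact: le_trans zs sc.
  have yC t : y t ^+ 2 <= C ^+ 2.
    have h := HC t.
    by rewrite -real_normK ?num_real// lerXn2r ?nnegrE// (le_trans _ h).
  (* By this time y^2, growing at rate at least 2 (y y')(s), exceeds C^2. *)
  pose t := s + (C ^+ 2 + 1) / (2 * (y s * y1 s)).
  have st : s <= t by rewrite lerDl divr_ge0 ?addr_ge0 ?sqr_ge0// mulr_ge0// ltW.
  have [c /andP[sc _] E] := is_derive_MVT st (fun t _ => Dy2 t).
  have : (C ^+ 2 + 1) <= y t ^+ 2 - y s ^+ 2.
    rewrite E /t addrAC subrr add0r [leRHS]mulrA ler_pdivlMr; last exact: mulr_gt0.
    rewrite mulrC.
    by apply: ler_wpM2r; [apply: addr_ge0 (sqr_ge0 _) _|rewrite ler_wpM2l// umono].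
  have := yC t; have := sqr_ge0 (y s); lra.
move=> s s0; have [sz|/ltW zs] := leP s z; first exact: low.
apply: le_trans (low z z0 (lexx z)).
have Dy2 (t : R) : is_derive t 1 (fun t => y t ^+ 2) (2 * (y t * y1 t)).
  by apply: is_derive_eq; rewrite /GRing.scale /=; ring.
have [c /andP[zc _] E] := is_derive_MVT zs (fun t _ => Dy2 t).
rewrite -(ler_pXn2r (ltn0Sn 1)) ?nnegrE// !real_normK ?num_real//.
by rewrite -subr_le0 E mulr_le0_ge0 ?subr_ge0// mulr_ge0_le0// u_le0.
Qed.

(** At s = 0 the three-term recurrence relates h_(l+2) to h_l with a factor of
    modulus at most 1, and odd Hermite functions vanish. *)
Lemma nhermite_at0 (R : realType) (l : nat) : `|pgauss1 (nhermite R l) 0| <= hermite_cst R 0.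
Proof.
have n0 : 0 <= hermite_cst R 0 by exact: powR_ge0.
have e0 : expR (- (0 : R) ^+ 2 / 2) = 1 by rewrite expr0n /= oppr0 mul0r expR0.
elim/ltn_ind: l => -[_|[_|l IH]].
- by rewrite /pgauss1 e0 mulr1 /nhermite hornerZ /= hornerE mulr1 ger0_norm.
- rewrite /pgauss1 e0 mulr1 /nhermite hornerZ !hornerE /= derivC horner0.
  by rewrite !mulr0 mul0r subr0 mulr0 normr0.
apply: le_trans (IH l _) => //.
have l2 : 0 < ladder R l.+2 by rewrite sqrtr_gt0 divr_gt0.
have := mulX_nhermite R l.+1; rewrite [l.+1.-1]/=.
move: (nhermite R l) (nhermite R l.+1) (nhermite R l.+2) => u v w.
move=> /(congr1 (fun p : {poly R} => p.[0])).
rewrite hornerM hornerX mul0r hornerD !hornerZ /pgauss1 e0 !mulr1 => /eqP.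
rewrite eq_sym addr_eq0 => /eqP H; rewrite -(ler_pM2l l2).
have -> : ladder R l.+2 * `|w.[0]| = ladder R l.+1 * `|u.[0]|.
  rewrite -{1}(ger0_norm (ladder_ge0 R l.+2)) -{1}(ger0_norm (ladder_ge0 R l.+1)).
  by rewrite -!normrM H normrN.
by rewrite ler_wpM2r// /ladder ler_sqrt ?divr_ge0// ler_wpM2r// ler_nat.
Qed.

(** The Sonin bound with lam = 2l+1; the values of h_l and h_l' at 0 are of size
    1 and sqrt(l). Negative arguments are covered by applying it to h_l(-s). *)
Lemma hermite1_sup (R : realType) : exists C : R,
  forall l s, `|pgauss1 (nhermite R l) s| <= C * l.+1%:R.
Proof.
pose c := hermite_cst R 0; have c0 : 0 <= c by exact: powR_ge0.
exists (5 * c) => l s; set q := nhermite R l; set q1 := q^`() - 'X * q.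
have l0 : 0 <= 2 * l%:R + 1 :> R by rewrite addr_ge0 ?mulr_ge0.
have [C HC'] := pgauss1_bound 0 q.
have HC t : `|pgauss1 q t| <= C by have := HC' t; rewrite expr0 mul1r.
have Dq (t : R) := is_derive_pgauss1 q t.
have Dq1 (t : R) : is_derive t 1 (pgauss1 q1) ((t ^+ 2 - (2 * l%:R + 1)) * pgauss1 q t).
  by rewrite -hermite_equation; exact: is_derive_pgauss1.
have H : `|pgauss1 q s| <= `|pgauss1 q 0| + Num.sqrt (2 * l%:R + 1) *
   Num.sqrt (pgauss1 q1 0 ^+ 2 + (2 * l%:R + 1) * pgauss1 q 0 ^+ 2).
  have [s0|/ltW s0] := leP 0 s; first exact: (sonin_bound l0 Dq Dq1 HC s0).
  have DN (t : R) : is_derive t 1 (fun t : R => - t) (- 1).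
    by apply: is_derive_eq.
  have Dr (t : R) : is_derive t 1 (fun t => pgauss1 q (- t)) (- pgauss1 q1 (- t)).
    by rewrite -mulrN1; exact: (is_derive1_comp (Dq (- t)) (DN t)).
  have Dr1 (t : R) : is_derive t 1 (fun t => - pgauss1 q1 (- t))
      ((t ^+ 2 - (2 * l%:R + 1)) * pgauss1 q (- t)).
    have D := is_derive1_comp (Dq1 (- t)) (DN t).
    apply: is_derive_eq (is_deriveN D) _.
    by rewrite sqrrN; ring.
  rewrite -oppr_ge0 in s0.
  have := sonin_bound l0 Dr Dr1 (fun t => HC (- t)) s0.
  by rewrite !oppr0 opprK sqrrN.
apply: le_trans H _.
have y0 := nhermite_at0 R l; rewrite -/q -/c in y0.
have y1 : pgauss1 q1 0 ^+ 2 <= 2 * l%:R * c ^+ 2.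
  have -> : pgauss1 q1 0 = 2 * ladder R l * pgauss1 (nhermite R l.-1) 0.
    rewrite /q1 /q deriv_nhermite /pgauss1 hornerD hornerN hornerM hornerX mul0r subr0.
    by rewrite [X in X * _]hornerZ mulrA.
  rewrite exprMn -(real_normK (num_real (pgauss1 _ _))) exprMn sqr_ladder.
  rewrite (_ : 2 ^+ 2 * _ = 2 * l%:R); last by field.
  by rewrite ler_wpM2l ?mulr_ge0// lerXn2r ?nnegrE// nhermite_at0.
have yy : pgauss1 q 0 ^+ 2 <= c ^+ 2.
  by rewrite -(real_normK (num_real (pgauss1 _ _))) lerXn2r ?nnegrE.
have L1 : 0 <= l%:R :> R by [].
have : Num.sqrt (2 * l%:R + 1) *
   Num.sqrt (pgauss1 q1 0 ^+ 2 + (2 * l%:R + 1) * pgauss1 q 0 ^+ 2) <=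
   (2 * l%:R + 2) * (2 * c).
  rewrite -sqrtrM// -[leRHS]ger0_norm ?mulr_ge0 ?addr_ge0 ?mulr_ge0//.
  rewrite -sqrtr_sqr ler_sqrt ?sqr_ge0//.
  apply: (@le_trans _ _ ((2 * l%:R + 1) * ((4 * l%:R + 1) * c ^+ 2))).
    rewrite ler_wpM2l//.
    have : (2 * l%:R + 1) * pgauss1 q 0 ^+ 2 <= (2 * l%:R + 1) * c ^+ 2.
      by rewrite ler_wpM2l.
    lra.
  rewrite mulrA exprMn.
  have -> : (2 * l%:R + 2) ^+ 2 * (2 * c) ^+ 2 = ((2 * l%:R + 2) ^+ 2 * 4) * c ^+ 2 by ring.
  by rewrite ler_wpM2r ?sqr_ge0//; nra.
rewrite -natr1; have : 0 <= l%:R * c by rewrite mulr_ge0.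
lra.
Qed.

Lemma ladder_le (R : realType) (l : nat) : ladder R l <= l.+1%:R.
Proof.
rewrite -[leRHS]ger0_norm// -sqrtr_sqr ler_sqrt ?sqr_ge0//.
have L0 : 0 <= l%:R :> R by [].
rewrite -[l.+1%:R]natr1; nra.
Qed.

(** Each factor |s| is traded, through s h_l = sqrt(l/2) h_(l-1) +
    sqrt((l+1)/2) h_(l+1), for a bounded power of l. *)
Lemma hermite1_decay (R : realType) (N : nat) : exists2 C : R, 0 <= C &
  forall l t, (1 + `|t|) ^+ N * `|pgauss1 (nhermite R l) t| <= C * l.+1%:R ^+ N.*2.+1.
Proof.
elim: N => [|N [C C0 IH]].
  have [C HC] := hermite1_sup R; exists `|C| => // l t.
  rewrite expr0 mul1r expr1 (le_trans (HC l t))// ler_wpM2r//.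
  exact: ler_norm.
have [D D0 HD] : exists2 D : R, 0 <= D & forall l,
    l.+1%:R ^+ N.*2.+1 + l.+1%:R * (l.+1%:R ^+ N.*2.+1 + l.+2%:R ^+ N.*2.+1)
    <= D * l.+1%:R ^+ N.+1.*2.+1 :> R.
  exists (2 + 2 ^+ N.*2.+1) => [|l]; first by rewrite addr_ge0 ?exprn_ge0.
  set a : R := l.+1%:R.
  have a1 : 1 <= a by rewrite ler1n.
  have -> : l.+2%:R = a + 1 :> R by rewrite /a natr1.
  have b : (a + 1) ^+ N.*2.+1 <= 2 ^+ N.*2.+1 * a ^+ N.*2.+1.
    rewrite -exprMn lerXn2r ?nnegrE ?addr_ge0 ?mulr_ge0//; lra.
  have -> : a ^+ N.+1.*2.+1 = a * (a * a ^+ N.*2.+1) by rewrite doubleS !exprS.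
  set u := a ^+ N.*2.+1 in b *; set v := 2 ^+ N.*2.+1 in b *.
  have u0 : 0 <= u by rewrite exprn_ge0 // ltW.
  have v0 : 0 <= v by rewrite exprn_ge0.
  apply: (@le_trans _ _ (u + a * (u + v * u))).
    by rewrite lerD2l ler_wpM2l ?lerD2l// ltW.
  have au : u <= a * u by rewrite ler_peMl.
  have aau : a * u <= a * (a * u) by rewrite ler_peMl// mulr_ge0// ltW.
  have avu : v * (a * u) <= v * (a * (a * u)) by rewrite ler_wpM2l.
  lra.
exists (C * D) => [|l t]; first exact: mulr_ge0.
apply: (@le_trans _ _ (C * (l.+1%:R ^+ N.*2.+1 +
   l.+1%:R * (l.+1%:R ^+ N.*2.+1 + l.+2%:R ^+ N.*2.+1)))); last first.
  by rewrite -mulrA ler_wpM2l.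
set w := (1 + `|t|) ^+ N; have w0 : 0 <= w by rewrite exprn_ge0 ?addr_ge0.
rewrite exprSr -/w -mulrA mulrDl mul1r !mulrDr.
rewrite lerD//; first exact: IH.
have -> : `|t| * `|pgauss1 (nhermite R l) t| = `|pgauss1 ('X * nhermite R l) t|.
  by rewrite /pgauss1 hornerM hornerX -mulrA !normrM mulrA.
rewrite mulX_nhermite.
have -> : pgauss1 (ladder R l *: nhermite R l.-1 + ladder R l.+1 *: nhermite R l.+1) t =
   ladder R l * pgauss1 (nhermite R l.-1) t + ladder R l.+1 * pgauss1 (nhermite R l.+1) t.
  move: (nhermite R l.-1) (nhermite R l.+1) => p q.
  by rewrite /pgauss1 hornerD !hornerZ mulrDl !mulrA.
apply: (@le_trans _ _ (w * (l.+1%:R * `|pgauss1 (nhermite R l.-1) t| +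
   l.+1%:R * `|pgauss1 (nhermite R l.+1) t|))).
  rewrite ler_wpM2l// (le_trans (ler_normD _ _))// !normrM.
  rewrite !(ger0_norm (ladder_ge0 _ _)) lerD// ler_wpM2r// ?ladder_le//.
  rewrite -[leRHS]ger0_norm// -sqrtr_sqr ler_sqrt ?sqr_ge0//.
  have L0 : 0 <= l%:R :> R by [].
  by rewrite -[l.+1%:R]natr1; nra.
have lm : l.-1.+1%:R ^+ N.*2.+1 <= l.+1%:R ^+ N.*2.+1 :> R.
  by rewrite lerXn2r ?nnegrE// ler_nat ltnS leq_pred.
have H1 := le_trans (IH l.-1 t) (ler_wpM2l C0 lm).
have H2 := IH l.+1 t.
rewrite -/w in H1 H2.
rewrite [leLHS](_ : _ = l.+1%:R * (w * `|pgauss1 (nhermite R l.-1) t| +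
  w * `|pgauss1 (nhermite R l.+1) t|)); last by ring.
rewrite [leRHS](_ : _ = l.+1%:R *
  (C * l.+1%:R ^+ N.*2.+1 + C * l.+2%:R ^+ N.*2.+1)); last by ring.
by rewrite ler_wpM2l// lerD.
Qed.

Notation mindex d := {ffun 'I_d -> nat}.

(** * Hermite functions of several variables *)

Definition kinc (d : nat) (i : 'I_d) (k : mindex d) : mindex d :=
  [ffun j => (k j + (j == i))%N].
(** Truncated at 0: k - e_i is k itself when k_i = 0, where it always comes with
    the coefficient [ladder R 0 = 0]. *)
Definition kdec (d : nat) (i : 'I_d) (k : mindex d) : mindex d :=
  [ffun j => (k j - (j == i))%N].

(** The eigenvalue of the harmonic oscillator -Laplacian + |x|^2 at h_k, which is
    also the base of the weights defining the p-norm. *)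
Definition osc_eig (R : realType) (d : nat) (k : mindex d) : R :=
  (2 * (\sum_(i < d) k i) + d)%N%:R.

Lemma sum_kinc (d : nat) (i : 'I_d) (k : mindex d) :
  (\sum_j kinc i k j = (\sum_j k j).+1)%N.
Proof.
under eq_bigr do rewrite ffunE.
rewrite big_split/= -[X in (_ + X)%N](big_mkcond (pred1 i) (fun=> 1%N)) /=.
by rewrite big_pred1_eq addn1.
Qed.

Lemma osc_eig_kinc (R : realType) (d : nat) (i : 'I_d) (k : mindex d) :
  osc_eig R (kinc i k) = osc_eig R k + 2.
Proof. by rewrite /osc_eig sum_kinc mulnS -addnA natrD addrC. Qed.

Lemma kdecK (d : nat) (i : 'I_d) (k : mindex d) :
  (0 < k i)%N -> kinc i (kdec i k) = k.
Proof.
move=> ki; apply/ffunP => j; rewrite !ffunE subnK//.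
by case: eqP => [->|].
Qed.

Lemma kincK (d : nat) (i : 'I_d) (k : mindex d) : kdec i (kinc i k) = k.
Proof. by apply/ffunP => j; rewrite !ffunE addnK. Qed.

Lemma osc_eig_kdec (R : realType) (d : nat) (i : 'I_d) (k : mindex d) :
  osc_eig R (kdec i k) <= osc_eig R k.
Proof.
rewrite ler_nat leq_add2r leq_mul2l/=; apply: leq_sum => j _.
by rewrite ffunE leq_subr.
Qed.

Lemma osc_eig_ge (R : realType) (d : nat) (i : 'I_d) (k : mindex d) :
  2 * (k i)%:R + 1 <= osc_eig R k.
Proof.
rewrite -natrM natr1 ler_nat (bigD1 i)//=.
by have := ltn_ord i; lia.
Qed.

Lemma one_le_osc_eig (R : realType) (d : nat) (d0 : (0 < d)%N) (k : mindex d) :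
  1 <= osc_eig R k.
Proof. by rewrite ler1n addn_gt0 d0 orbT. Qed.

Lemma hermite_funE (R : realType) (d : nat) (k : mindex d) :
  hermite_fun k = pgauss (fun i => nhermite R (k i)).
Proof.
by apply/funext => x; rewrite /hermite_fun /pgauss; apply: eq_bigr => i _; rewrite hermite1E.
Qed.

Lemma pgaussD1 (R : realType) (d : nat) (j : 'I_d) (q : 'I_d -> {poly R}) x :
  pgauss q x = pgauss1 (q j) (x 0 j) *
    \prod_(i < d | i != j) pgauss1 (q i) (x 0 i).
Proof. by rewrite /pgauss (bigD1 j). Qed.

Lemma pgauss_step_nhermite (R : realType) (d : nat) (k : mindex d) (i : 'I_d) x :
  pgauss (pgauss_step i (fun i => nhermite R (k i))) x =
  ladder R (k i) * hermite_fun (kdec i k) x - ladder R (k i).+1 * hermite_fun (kinc i k) x.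
Proof.
have E (q : 'I_d -> {poly R}) : (forall j, j != i -> q j = nhermite R (k j)) ->
    pgauss q x = pgauss1 (q i) (x 0 i) *
      \prod_(j < d | j != i) pgauss1 (nhermite R (k j)) (x 0 j).
  by move=> H; rewrite (pgaussD1 i); congr (_ * _); apply: eq_bigr => j /H ->.
rewrite !hermite_funE !E; first last.
- by move=> j /negbTE ji; rewrite /pgauss_step ji.
- by move=> j /negbTE ji; rewrite ffunE ji subn0.
- by move=> j /negbTE ji; rewrite ffunE ji addn0.
rewrite /pgauss_step eqxx dgauss_nhermite !ffunE eqxx addn1 subn1.
move: (nhermite R (k i).-1) (nhermite R (k i).+1) => p q.
by rewrite /pgauss1 hornerD hornerN !hornerZ; ring.
Qed.

Lemma derive_hermite (R : realType) (d : nat) (k : mindex d) (i : 'I_d) :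
  'D_(delta_mx 0 i : 'rV[R]_d) (hermite_fun k) =
  (ladder R (k i) *: hermite R (kdec i k) - ladder R (k i).+1 *: hermite R (kinc i k)
    : schwartz R d).
Proof.
apply/funext => x; rewrite hermite_funE.
have [_ ->] := is_derive_pgauss (fun i => nhermite R (k i)) i x.
by rewrite pgauss_step_nhermite.
Qed.

Lemma norm_le_prod (R : realType) (d : nat) (x : 'rV[R]_d) :
  1 + `|x| <= \prod_(i < d) (1 + `|x 0 i|).
Proof.
have ge1 (P : pred 'I_d) : 1 <= \prod_(i < d | P i) (1 + `|x 0 i|).
  elim/big_ind: _ => // [a b|i _]; last by rewrite lerDl.
  exact: mulr_ege1.
have [->|] := eqVneq `|x| 0; first by rewrite addr0.
move=> /mx_norm_neq0[[i j] /=]; rewrite ord1 => Ej.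
by rewrite [`|x|]Ej (bigD1 j)//= ler_peMr ?addr_ge0.
Qed.

Lemma hermite_decay (R : realType) (d N : nat) : exists C : R, exists2 M : nat,
  0 <= C & forall (k : mindex d) x,
  (1 + `|x|) ^+ N * `|hermite_fun k x| <= C * osc_eig R k ^+ M.
Proof.
have [C C0 HC] := hermite1_decay R N.
exists (C ^+ d), (N.*2.+1 * d)%N => [|k x]; first exact: exprn_ge0.
apply: (@le_trans _ _ (\prod_(i < d)
    ((1 + `|x 0 i|) ^+ N * `|pgauss1 (nhermite R (k i)) (x 0 i)|))).
  rewrite big_split/= hermite_funE /pgauss normr_prod ler_wpM2r ?prodr_ge0//.
  by rewrite prodrXl lerXn2r ?nnegrE ?addr_ge0 ?prodr_ge0// norm_le_prod.
apply: (@le_trans _ _ (\prod_(i < d) (C * osc_eig R k ^+ N.*2.+1))).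
  apply: ler_prod => i _; rewrite mulr_ge0 ?exprn_ge0 ?addr_ge0//=.
  rewrite (le_trans (HC _ _))// ler_wpM2l// lerXn2r ?nnegrE//.
  rewrite (le_trans _ (osc_eig_ge R i k))// -natr1.
  by have : 0 <= (k i)%:R :> R by []; lra.
by rewrite prodr_const card_ord exprMn -exprM.
Qed.

(** The Schwartz seminorms of h_k grow at most polynomially in k: every
    derivative is a ladder step. *)
Lemma partials_hermite_decay (R : realType) (d : nat) (d0 : (0 < d)%N) (n N : nat) :
  exists C : R, exists2 M : nat,
  0 <= C & forall (k : mindex d) s x, (size s <= n)%N ->
  (1 + `|x|) ^+ N * `|partials s (hermite R k) x| <= C * osc_eig R k ^+ M.
Proof.
elim: n => [|n [C [M C0 IH]]].
  have [C [M C0 H]] := hermite_decay R d N; exists C, M => // k s x.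
  by rewrite leqn0 size_eq0 => /eqP ->; exact: H.
exists (C * (2 * 3 ^+ M)), M.+1 => [|k s x]; first by rewrite !mulr_ge0 ?exprn_ge0.
have l1 := one_le_osc_eig R d0 k.
have l0 : 0 <= osc_eig R k by exact: le_trans l1.
have M3 : 1 <= 3 ^+ M :> R by rewrite exprn_ege1// ler1n.
rewrite leq_eqVlt => /orP[|sn]; last first.
  apply: (le_trans (IH k s x sn)); rewrite -mulrA ler_wpM2l//.
  rewrite exprS mulrA ler_peMl ?exprn_ge0// mulr_ege1//.
  by rewrite -[leLHS]mulr1 ler_pM// ler1n.
case/lastP: s => [//|s i]; rewrite size_rcons eqSS => /eqP sn.
rewrite /partials foldr_rcons -/(partials s _) derive_hermite.
rewrite schwartz_partialsD -scaleNr !schwartz_partialsZ.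
set w := (1 + `|x|) ^+ N; have w0 : 0 <= w by rewrite exprn_ge0 ?addr_ge0.
have H1 := IH (kdec i k) s x (eq_leq sn); have H2 := IH (kinc i k) s x (eq_leq sn).
rewrite -/w in H1 H2.
set u := partials s _ x in H1; set v := partials s _ x in H2.
apply: (@le_trans _ _ (w * (osc_eig R k * `|u| + osc_eig R k * `|v|))).
  rewrite ler_wpM2l// (le_trans (ler_normD _ _))//.
  have k0 : 0 <= (k i)%:R :> R by [].
  have ladl m : (m <= (k i).+1)%N -> ladder R m <= osc_eig R k.
    move=> mk; rewrite -[leRHS]ger0_norm// -sqrtr_sqr ler_sqrt ?sqr_ge0//.
    apply: (@le_trans _ _ ((k i).+1%:R / 2)); first by rewrite ler_wpM2r// ler_nat.
    rewrite -[(k i).+1%:R]natr1; have := osc_eig_ge R i k; nra.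
  by apply: lerD; rewrite [X in `|X|]/GRing.scale /= normrM ?normrN
    (ger0_norm (ladder_ge0 _ _)) ler_wpM2r// ladl.
rewrite -mulrDr mulrCA exprS.
rewrite [leRHS](_ : _ = osc_eig R k *
  (C * (3 ^+ M * osc_eig R k ^+ M) + C * (3 ^+ M * osc_eig R k ^+ M))); last by ring.
rewrite ler_wpM2l// mulrDr -exprMn; apply: lerD.
  apply: (le_trans H1); rewrite ler_wpM2l// lerXn2r ?nnegrE ?mulr_ge0//.
  apply: (le_trans (osc_eig_kdec _ _ _)); lra.
apply: (le_trans H2); rewrite ler_wpM2l// lerXn2r ?nnegrE ?mulr_ge0//.
rewrite osc_eig_kinc; lra.
Qed.

(** * Differentiating translates of tempered distributions *)

Lemma is_derive_prod (R : realType) (I : eqType) (r : seq I) (f df : I -> R -> R)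
    (t : R) : uniq r ->
  (forall i, is_derive t 1 (f i) (df i t)) ->
  is_derive t 1 (fun t => \prod_(i <- r) f i t)
    (\sum_(i <- r) df i t * \prod_(j <- r | j != i) f j t).
Proof.
move=> + D; elim: r => [_|a r IH /= /andP[ar ur]].
  under eq_fun do rewrite big_nil; rewrite big_nil.
  exact: is_derive_cst.
under eq_fun do rewrite big_cons.
have IHr := IH ur.
apply: is_derive_eq (is_deriveM (D a) IHr) _.
rewrite /GRing.scale /= big_cons big_cons eqxx /= addrC; congr (_ + _).
  rewrite mulrC; congr (_ * _); rewrite [RHS]big_seq_cond [LHS]big_seq; apply: eq_bigl => j.
  by case: (boolP (j \in r)) => //= jr; apply/esym; apply: contraNneq ar => <-.
rewrite mulr_sumr [LHS]big_seq [RHS]big_seq; apply: eq_bigr => i ir.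
rewrite big_cons ifT; first by rewrite mulrCA.
by apply: contraNneq ar => ->.
Qed.

Lemma is_derive_pgauss_line (R : realType) (d : nat) (q : 'I_d -> {poly R})
    (x y : 'rV[R]_d) (t : R) :
  is_derive t 1 (fun t : R => pgauss q (y + t *: x))
    (\sum_i x 0 i * pgauss (pgauss_step i q) (y + t *: x)).
Proof.
have E q' (s : R) : pgauss q' (y + s *: x) = \prod_i pgauss1 (q' i) (y 0 i + s * x 0 i).
  by apply: eq_bigr => i _; rewrite !mxE.
under eq_fun do rewrite E.
have D (i : 'I_d) : is_derive t 1 (fun s : R => pgauss1 (q i) (y 0 i + s * x 0 i))
    (x 0 i * pgauss1 ((q i)^`() - 'X * q i) (y 0 i + t * x 0 i)).
  have D1 : is_derive t 1 (fun s : R => y 0 i + s * x 0 i) (x 0 i).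
    by apply: is_derive_eq; rewrite /GRing.scale /=; ring.
  rewrite mulrC; exact: (is_derive1_comp (is_derive_pgauss1 (q i) _) D1).
apply: is_derive_eq (@is_derive_prod R _ (index_enum 'I_d)
  (fun i s => pgauss1 (q i) (y 0 i + s * x 0 i))
  (fun i t => x 0 i * pgauss1 ((q i)^`() - 'X * q i) (y 0 i + t * x 0 i))
  t (index_enum_uniq _) D) _.
apply: eq_bigr => i _; rewrite (pgaussD1 i) -mulrA !mxE /pgauss_step eqxx.
congr (_ * (_ * _)).
by apply: eq_bigr => j /negbTE ji; rewrite ji !mxE.
Qed.

(** Taylor's formula of order one with remainder; h may be negative. *)
Lemma taylor1_bound (R : realType) (f f1 f2 : R -> R) (h B : R) :
  (forall t : R, is_derive t 1 f (f1 t)) -> (forall t : R, is_derive t 1 f1 (f2 t)) ->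
  (forall t, `|t| <= `|h| -> `|f2 t| <= B) ->
  `|f h - f 0 - h * f1 0| <= B * h ^+ 2.
Proof.
move=> D1 D2 HB.
have step u a b : a <= b -> (forall t, a <= t <= b -> `|t| <= `|h|) ->
    exists2 c, `|c| <= `|h| & f b - f a - (b - a) * f1 u = (f1 c - f1 u) * (b - a).
  move=> ab H; have [c cab E] := is_derive_MVT ab (fun t _ => D1 t).
  by exists c; [exact: H|rewrite E; ring].
have fc c : `|c| <= `|h| -> `|f1 c - f1 0| <= B * `|h|.
  move=> ch; have B0 : 0 <= B by apply: le_trans (HB 0 _); rewrite ?normr0.
  have [c0|/ltW c0] := leP 0 c.
    have [e /andP[e0 ec] ->] := is_derive_MVT c0 (fun t _ => D2 t).
    rewrite subr0 normrM ler_pM// HB//.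
    by rewrite ger0_norm// (le_trans ec)// -[leLHS]ger0_norm.
  have [e /andP[e0 ec] E] := is_derive_MVT c0 (fun t _ => D2 t).
  rewrite distrC E sub0r normrM normrN ler_pM// HB//.
  by rewrite ler0_norm// (le_trans _ ch)// ler0_norm// lerN2.
have -> : h ^+ 2 = `|h| * `|h| by rewrite -expr2 real_normK// num_real.
rewrite mulrA; have [h0|/ltW h0] := leP 0 h.
  have [t /andP[t0 th]|c ch] := step 0 _ _ h0.
    by rewrite !ger0_norm// (le_trans t0).
  by rewrite !subr0 => ->; rewrite normrM ler_wpM2r// fc.
have [t /andP[t0 th]|c ch] := step 0 _ _ h0.
  by rewrite !ler0_norm// lerN2.
rewrite sub0r => E.
have -> : f h - f 0 - h * f1 0 = - (f 0 - f h - (- h) * f1 0) by ring.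
by rewrite normrN E normrM normrN ler_wpM2r// fc.
Qed.

(** Makes constants that depend on a multi-index uniform over the finitely many
    multi-indices of bounded length. *)
Lemma uniform_seq (R : realType) (T : finType) (Q : seq T -> R -> Prop) :
  (forall s C D, C <= D -> Q s C -> Q s D) -> (forall s, exists C, Q s C) ->
  forall n, exists2 C, 0 <= C & forall s, (size s <= n)%N -> Q s C.
Proof.
move=> mono H n; elim: n => [|n IH] in Q mono H *.
  have [C HC] := H [::]; exists `|C| => // s; rewrite leqn0 size_eq0 => /eqP ->.
  by apply: mono HC; exact: ler_norm.
have [C HC] := H [::].
have /choice[D HD] i : exists C, 0 <= C /\ forall s, (size s <= n)%N -> Q (i :: s) C.
  have [C' ? ?] := IH (fun s => Q (i :: s)) (fun s => mono (i :: s))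
    (fun s => H (i :: s)).
  by exists C'.
have S0 : 0 <= \sum_i D i by apply: sumr_ge0 => i _; exact: (HD i).1.
exists (`|C| + \sum_i D i) => [|s]; first exact: addr_ge0.
case: s => [_|i s].
  by apply: mono HC; rewrite (le_trans (ler_norm _))// lerDl.
rewrite /= ltnS => sn; apply: mono ((HD i).2 s sn).
rewrite (bigD1 i)//= addrCA lerDl addr_ge0//.
by apply: sumr_ge0 => j _; exact: (HD j).1.
Qed.

Lemma temperedD (R : realType) (d : nat) (u : tempered R d) f g :
  u (f + g) = u f + u g.
Proof. by have := tempered_lin u 1 f g; rewrite scale1r mul1r. Qed.

Lemma tempered0 (R : realType) (d : nat) (u : tempered R d) : u 0 = 0.
Proof. by have /eqP := temperedD u 0 0; rewrite addr0 -subr_eq subrr => /eqP. Qed.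

Lemma temperedZ (R : realType) (d : nat) (u : tempered R d) a f :
  u (a *: f) = a * u f.
Proof. by have := tempered_lin u a f 0; rewrite !addr0 tempered0 addr0. Qed.

Lemma temperedB (R : realType) (d : nat) (u : tempered R d) f g :
  u (f - g) = u f - u g.
Proof. by rewrite temperedD -scaleN1r temperedZ mulN1r. Qed.

(** Continuity at 0 for the Frechet topology, plus homogeneity. *)
Lemma tempered_bound (R : realType) (d : nat) (u : tempered R d) :
  exists N : nat, exists2 K : R, 0 <= K & forall (f : schwartz R d) M, 0 < M ->
    schwartz_ball N M f -> `|u f| <= K * M.
Proof.
have c0 := @tempered_cont R d u 0.
have : nbhs (u 0) [set y : R | `|y| < 1].
  by rewrite tempered0; exists 1 => //= y; rewrite /= sub0r normrN.
move=> /c0[[N e] /= e0 H].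
exists N, e^-1; first by rewrite invr_ge0 ltW.
move=> f M M0 fM.
have eM : 0 <= e / M by rewrite divr_ge0// ltW.
have : `|u ((e / M) *: f)| < 1.
  apply: H => /=; rewrite subr0 => s y sN.
  rewrite schwartz_partialsZ.
  have -> : ((e / M) *: partials s f) y = (e / M) * partials s f y by [].
  rewrite normrM mulrCA.
  rewrite ger0_norm// -[leRHS](@divfK _ M) ?gt_eqF// ler_wpM2l//.
  exact: fM.
rewrite temperedZ normrM ger0_norm// => /ltW.
by rewrite mulrC mulrA ler_pdivrMr// mul1r -ler_pdivlMr// mulrC.
Qed.

Lemma is_derive_quadratic (R : realType) (F : R -> R) (t D C : R) :
  (forall h, `|h| <= 1 -> `|F (t + h) - F t - h * D| <= C * h ^+ 2) ->
  is_derive t 1 F D.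
Proof.
move=> H.
have cv : h^-1 *: ((F \o shift t) (h *: (1 : R)) - F t) @[h --> 0^'] --> D.
  apply/cvgrPdist_le => e e0.
  near=> h.
  have h0 : h != 0 by near: h; exact: nbhs_dnbhs_neq.
  have h1 : `|h| <= 1 by near: h; apply: dnbhs0_le.
  have hC : `|h| <= e / (`|C| + 1) by near: h; apply: dnbhs0_le; rewrite divr_gt0// ltr_wpDl.
  rewrite /= /GRing.scale /= mulr1 distrC addrC [h + t]addrC.
  have -> : - D + h^-1 * (F (t + h) - F t) = h^-1 * (F (t + h) - F t - h * D) by field.
  rewrite normrM normfV ler_pdivrMl ?normr_gt0//.
  apply: le_trans (H h h1) _.
  have -> : h ^+ 2 = `|h| * `|h| by rewrite -expr2 real_normK// num_real.
  rewrite mulrCA ler_wpM2l//.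
  apply: (@le_trans _ _ ((`|C| + 1) * `|h|)).
    by rewrite ler_wpM2r// (le_trans (ler_norm _))// lerDl.
  by rewrite mulrC -ler_pdivlMr// ltr_wpDl.
split; first by apply/cvg_ex; exists D.
exact: cvg_lim cv.
Unshelve. all: by end_near.
Qed.

Lemma partials_pgaussE (R : realType) (d : nat) (s : seq 'I_d)
    (q : 'I_d -> {poly R}) :
  partials s (pgauss q) = pgauss (foldr (@pgauss_step R d) q s).
Proof.
elim: s => [//|i s IH] /=; rewrite IH; apply/funext => x.
by have [] := is_derive_pgauss (foldr (@pgauss_step R d) q s) i x.
Qed.

(** Symmetry of second derivatives, which is immediate on polynomial factors. *)
Lemma pgauss_stepC (R : realType) (d : nat) (i j : 'I_d) (q : 'I_d -> {poly R}) :
  pgauss_step i (pgauss_step j q) = pgauss_step j (pgauss_step i q).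
Proof.
by apply/funext => k; rewrite /pgauss_step; case: (k == i); case: (k == j).
Qed.

Lemma foldr_pgauss_step (R : realType) (d : nat) (i : 'I_d) s (q : 'I_d -> {poly R}) :
  foldr (@pgauss_step R d) (pgauss_step i q) s =
  pgauss_step i (foldr (@pgauss_step R d) q s).
Proof. by elim: s => [//|j s IH] /=; rewrite IH pgauss_stepC. Qed.

(** The derivative of h_k in the direction x, written in the Hermite basis so that
    it is visibly a Schwartz function. *)
Definition dir_derive (R : realType) (d : nat) (x : 'rV[R]_d) (k : mindex d) :
  schwartz R d :=
  \sum_i x 0 i *: (ladder R (k i) *: hermite R (kdec i k)
                   - ladder R (k i).+1 *: hermite R (kinc i k)).

Lemma partials_dir_derive (R : realType) (d : nat) (x : 'rV[R]_d) (k : mindex d) s y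
    (q := foldr (@pgauss_step R d) (fun i => nhermite R (k i)) s) :
  partials s (dir_derive x k) y = \sum_i x 0 i * pgauss (pgauss_step i q) y.
Proof.
have E0 : partials s (0 : schwartz R d) y = 0 by rewrite (partials0 R s).
rewrite /dir_derive (@big_morph _ _ (fun f : schwartz R d => partials s f y) 0 +%R 0 +%R _ E0);
  last by move=> f g; rewrite schwartz_partialsD.
apply: eq_bigr => i _; rewrite schwartz_partialsZ; congr (_ * _).
rewrite -foldr_pgauss_step -partials_pgaussE; congr (partials s _ y).
by apply/funext => z; rewrite pgauss_step_nhermite.
Qed.

(** The difference quotients of t |-> h_k(. + t x) converge in the Schwartz
    topology, with a linear rate: the remainder of each derivative is controlled
    by second derivatives, which are again polynomials times Gaussians. *)
Lemma hermite_translate_taylor (R : realType) (d N : nat) (x : 'rV[R]_d)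
    (k : mindex d) : exists2 C : R, 0 <= C & forall h : R, `|h| <= 1 ->
  schwartz_ball N (C * h ^+ 2)
    (translateS (- (h *: x)) (hermite R k) - hermite R k - h *: dir_derive x k).
Proof.
pose Q s C := forall (h : R) (y : 'rV[R]_d), `|h| <= 1 -> (1 + `|y|) ^+ N *
  `|partials s (translateS (- (h *: x)) (hermite R k) - hermite R k - h *: dir_derive x k) y|
   <= C * h ^+ 2.
suff [C C0 HC] : exists2 C, 0 <= C & forall s, (size s <= N)%N -> Q s C.
  by exists C => // h h1 s y sN; exact: HC.
apply: uniform_seq.
  move=> s C D CD HC h y h1; apply: le_trans (HC h y h1) _.
  by rewrite ler_wpM2r// sqr_ge0.
move=> s; set q := foldr (@pgauss_step R d) (fun i => nhermite R (k i)) s.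
have qE : partials s (hermite R k) = pgauss q.
  by rewrite /q -partials_pgaussE; congr (partials s _); rewrite -hermite_funE.
pose qq i j := pgauss_step j (pgauss_step i q).
have /choice[B HB] i : exists B : 'I_d -> R, forall j z,
    (1 + `|z|) ^+ N * `|pgauss (qq i j) z| <= B j.
  have /choice[B HB] j : exists B : R, forall z,
    (1 + `|z|) ^+ N * `|pgauss (qq i j) z| <= B.
    by have [B HB] := rapidly_decreasing_pgauss (qq i j) N [::]; exists B.
  by exists B.
exists (\sum_i `|x 0 i| * \sum_j `|x 0 j| * ((1 + `|x|) ^+ N * B i j)) => h y h1.
rewrite -(scaleNr h (dir_derive x k)) schwartz_partialsD schwartz_partialsD schwartz_partialsZ.
rewrite -(scaleN1r (hermite R k)) schwartz_partialsZ qE.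
rewrite [X in X + _ + _]partials_translate qE.
have -> : (translate_fun (- (h *: x)) (pgauss q) + -1 *: pgauss q +
     (- h) *: partials s (dir_derive x k)) y =
   pgauss q (y + h *: x) - pgauss q y - h * \sum_i x 0 i * pgauss (pgauss_step i q) y.
  rewrite -partials_dir_derive /translate_fun.
  change (pgauss q (y - - (h *: x)) + -1 * pgauss q y + - h * partials s (dir_derive x k) y =
    pgauss q (y + h *: x) - pgauss q y - h * partials s (dir_derive x k) y).
  by rewrite opprK mulN1r mulNr.
set w := (1 + `|y|) ^+ N; have w0 : 0 < w by rewrite exprn_gt0// ltr_pwDl.
rewrite mulrC -ler_pdivlMr// mulrAC.
pose f t := pgauss q (y + t *: x).
pose f1 t := \sum_i x 0 i * pgauss (pgauss_step i q) (y + t *: x).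
pose f2 t := \sum_i x 0 i * \sum_j x 0 j * pgauss (qq i j) (y + t *: x).
have D1 (t : R) : is_derive t 1 f (f1 t) by exact: is_derive_pgauss_line.
have D2 (t : R) : is_derive t 1 f1 (f2 t).
  have -> : f1 = \sum_i (fun t => x 0 i * pgauss (pgauss_step i q) (y + t *: x)).
    by apply/funext => u; rewrite fct_sumE.
  apply: is_derive_sum => i; apply: is_deriveZ.
  exact: is_derive_pgauss_line.
have := @taylor1_bound R f f1 f2 h _ D1 D2.
rewrite /f /f1 !scale0r !addr0; apply => t th.
rewrite ler_pdivlMr// mulrC /f2.
apply: (@le_trans _ _ (w * \sum_i `|x 0 i| *
  \sum_j `|x 0 j| * `|pgauss (qq i j) (y + t *: x)|)).
  rewrite ler_wpM2l ?(ltW w0)// (le_trans (ler_norm_sum _ _ _))//.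
  apply: ler_sum => i _; rewrite normrM ler_wpM2l//.
  rewrite (le_trans (ler_norm_sum _ _ _))//.
  by apply: ler_sum => j _; rewrite normrM.
rewrite mulr_sumr; apply: ler_sum => i _; rewrite mulrCA ler_wpM2l//.
rewrite mulr_sumr; apply: ler_sum => j _; rewrite mulrCA ler_wpM2l//.
have := weight_translate N (- (t *: x)) y (pgauss (qq i j) (y + t *: x)).
rewrite opprK -/w => /le_trans; apply.
apply: ler_pM; rewrite ?exprn_ge0 ?mulr_ge0 ?exprn_ge0 ?addr_ge0//.
rewrite lerXn2r ?nnegrE ?addr_ge0// lerD2l normrN normrZ.
by rewrite ler_piMl// (le_trans th).
Qed.

Definition translate_coef (R : realType) (d : nat) (x : 'rV[R]_d) (phi : tempered R d)
    (k : mindex d) (t : R) : R := translate (t *: x) phi (hermite R k).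

(** By the group property of translations it suffices to differentiate at t = 0,
    for the distribution tau_(tx) phi in place of phi. *)
Lemma is_derive_translate_coef (R : realType) (d : nat) (x : 'rV[R]_d) (phi : tempered R d)
    (k : mindex d) (t : R) :
  is_derive t 1 (translate_coef x phi k) (\sum_i x 0 i *
    (ladder R (k i) * translate_coef x phi (kdec i k) t -
     ladder R (k i).+1 * translate_coef x phi (kinc i k) t)).
Proof.
set u := translate (t *: x) phi.
have [N [K K0 HK]] := tempered_bound u.
have [C C0 HC] := hermite_translate_taylor N x k.
apply: (@is_derive_quadratic _ _ _ _ (K * (C + 1))) => h h1.
have -> : \sum_i x 0 i * (ladder R (k i) * translate_coef x phi (kdec i k) t
     - ladder R (k i).+1 * translate_coef x phi (kinc i k) t) = u (dir_derive x k).
  rewrite /dir_derive (@big_morph _ _ u 0 +%R 0 +%R (temperedD u) (tempered0 u)).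
  by apply: eq_bigr => i _; rewrite temperedZ temperedB !temperedZ.
have -> : translate_coef x phi k (t + h) = u (translateS (- (h *: x)) (hermite R k)).
  rewrite /translate_coef /u /translate /=; congr (phi _); apply/val_inj/funext => y /=.
  by rewrite /translate_fun; congr (hermite_fun k _); rewrite scalerDl !opprK addrA.
have [->|h0] := eqVneq h 0.
  rewrite scale0r oppr0 expr0n /= mulr0 mul0r subr0.
  have -> : translateS 0 (hermite R k) = hermite R k.
    by apply/val_inj/funext => y /=; rewrite /translate_fun subr0.
  by rewrite subrr normr0.
rewrite -!temperedZ -!temperedB -mulrA; apply: HK.
  by rewrite mulr_gt0 ?ltr_wpDl// lt_neqAle sqr_ge0 eq_sym sqrf_eq0 h0.
apply: schwartz_ball_le (HC h h1) => //.
by rewrite ler_wpM2r ?sqr_ge0// lerDl.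
Qed.

(** The range |t| <= 1 keeps the seminorms of the translates comparable to those of
    h_k. *)
Lemma translate_coef_growth (R : realType) (d : nat) (d0 : (0 < d)%N) (x : 'rV[R]_d)
    (phi : tempered R d) : exists B : R, exists2 M : nat, 0 <= B &
  forall k t, `|t| <= 1 -> `|translate_coef x phi k t| <= B * osc_eig R k ^+ M.
Proof.
have [N [K K0 HK]] := tempered_bound phi.
have [C [M C0 HC]] := partials_hermite_decay R d0 N N.
exists (K * ((1 + `|x|) ^+ N * (C + 1))), M => [|k t t1].
  by rewrite !mulr_ge0 ?exprn_ge0 ?addr_ge0.
have l0 : 0 < osc_eig R k by exact: lt_le_trans (one_le_osc_eig R d0 k).
rewrite -mulrA; apply: HK.
  apply: mulr_gt0; last exact: exprn_gt0.
  by apply: mulr_gt0; [rewrite exprn_gt0 // ltr_pwDl|rewrite ltr_wpDl].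
move=> s y sN; rewrite [partials s _]partials_translate.
apply: le_trans (weight_translate N (- (t *: x)) y _) _.
rewrite -mulrA ler_pM ?exprn_ge0 ?mulr_ge0 ?exprn_ge0 ?addr_ge0//.
  rewrite lerXn2r ?nnegrE ?addr_ge0// lerD2l !normrN normrZ.
  by rewrite ler_piMl.
apply: le_trans (HC k s _ sN) _.
by rewrite ler_wpM2r ?exprn_ge0 ?(ltW l0)// lerDl.
Qed.

(** * Energy inequality for the translation flow *)

Definition simplex (d n : nat) : seq (mindex d) :=
  [seq k <- [seq [ffun i => val (b i)] | b : {ffun 'I_d -> 'I_n.+1}]
     | (\sum_i (k : mindex d) i <= n)%N].

Lemma mem_simplex (d n : nat) (k : mindex d) :
  (k \in simplex d n) = (\sum_i k i <= n)%N.
Proof.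
rewrite mem_filter andb_idr// => kn.
apply/mapP; exists [ffun i => inord (k i)]; first by rewrite mem_enum.
apply/ffunP => i; rewrite !ffunE /= inordK// ltnS (leq_trans _ kn)//.
by rewrite (bigD1 i)//= leq_addr.
Qed.

Lemma uniq_simplex (d n : nat) : uniq (simplex d n).
Proof.
apply: filter_uniq; rewrite map_inj_uniq ?enum_uniq// => b c /ffunP E.
by apply/ffunP => i; have := E i; rewrite !ffunE => /val_inj.
Qed.

Lemma size_simplex (d n : nat) : (size (simplex d n) <= n.+1 ^ d)%N.
Proof.
rewrite (leq_trans (size_subseq (filter_subseq _ _)))// size_map -cardT.
by rewrite card_ffun !card_ord.
Qed.

(** Summation by parts on the lattice: k |-> k + e_i is a bijection from
    |k| < n onto the part k_i > 0 of |k| <= n. *)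
Lemma sum_simplex_shift (R : realType) (d n : nat) (i : 'I_d) (G : mindex d -> R) :
  (forall k : mindex d, k i = 0%N -> G k = 0) ->
  \sum_(k <- simplex d n) G k =
  \sum_(k <- simplex d n | (\sum_j (k : mindex d) j < n)%N) G (kinc i k).
Proof.
move=> G0; rewrite (bigID (fun k : mindex d => 0 < k i)%N)/=.
rewrite [X in _ + X]big1 ?addr0; last by move=> k; rewrite lt0n negbK => /eqP /G0.
rewrite -[LHS]big_filter -[RHS]big_filter -[RHS](big_map (kinc i) xpredT G).
apply: perm_big; apply: uniq_perm; first by rewrite filter_uniq// uniq_simplex.
  rewrite map_inj_uniq; first by rewrite filter_uniq// uniq_simplex.
  exact: can_inj (@kincK d i).
move=> k; rewrite mem_filter mem_simplex; apply/andP/mapP => [[k0 kn]|[l + ->]].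
  exists (kdec i k); last by rewrite kdecK.
  have e := sum_kinc i (kdec i k); rewrite kdecK// in e; rewrite e in kn.
  by rewrite mem_filter mem_simplex kn ltnW.
rewrite mem_filter mem_simplex => /andP[ln _].
by rewrite sum_kinc ln ffunE eqxx addn1.
Qed.

Lemma is_derive_sum_seq (R : realType) (I : Type) (r : seq I) (f : I -> R -> R)
    (df : I -> R) (t : R) : (forall i, is_derive t 1 (f i) (df i)) ->
  is_derive t 1 (fun t => \sum_(i <- r) f i t) (\sum_(i <- r) df i).
Proof.
move=> D; elim: r => [|a r IH].
  by under eq_fun do rewrite big_nil; rewrite big_nil; exact: is_derive_cst.
by under eq_fun do rewrite big_cons; rewrite big_cons; exact: is_deriveD.
Qed.

Section Energy.
Variables (R : realType) (d : nat) (d0 : (0 < d)%N) (x : 'rV[R]_d).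
(** [Th k t] bounds the coupling of k to each of its neighbours, per unit of
    a_k^2. *)
Variables (a W dW Th : mindex d -> R -> R) (B : R).
Hypothesis Da : forall (k : mindex d) (t : R), is_derive t 1 (a k) (\sum_i x 0 i *
  (ladder R (k i) * a (kdec i k) t - ladder R (k i).+1 * a (kinc i k) t)).
Hypothesis DW : forall k (t : R), 0 <= t <= 1 -> is_derive t 1 (W k) (dW k t).
Hypothesis W_ge0 : forall k t, 0 <= W k t.
Hypothesis Th_ge0 : forall k t, 0 <= t <= 1 -> 0 <= Th k t.
Hypothesis edge : forall i (k : mindex d) t, 0 <= t <= 1 ->
  ladder R (k i).+1 * `|W (kinc i k) t - W k t| <= Num.min (Th k t) (Th (kinc i k) t).
Hypothesis dissip : forall k t, 0 <= t <= 1 ->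
  2 * (\sum_i `|x 0 i|) * Th k t <= - dW k t.
Hypothesis decay : forall i (k : mindex d) t, 0 <= t <= 1 ->
  W k t * ladder R (k i).+1 * (`|a k t| * `|a (kinc i k) t|) * osc_eig R k ^+ d.+1 <= B.

Let E n t := \sum_(k <- simplex d n) W k t * a k t ^+ 2.

Let flux n t i := \sum_(k <- simplex d n) 2 * W k t * a k t *
  (ladder R (k i) * a (kdec i k) t - ladder R (k i).+1 * a (kinc i k) t).

(** Reindexing the lowering terms pairs both contributions of each edge
    (k, k + e_i) into 2 sqrt((k_i+1)/2) (W_(k+e_i) - W_k) a_k a_(k+e_i), which
    [edge] bounds by the squares at the two ends. Only the edges leaving the
    simplex remain unpaired; there are at most (n+1)^d of them, each of size
    O(n^(-d-1)) by [decay]. *)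
Lemma flux_le n t i : 0 <= t <= 1 -> `|flux n t i| <=
  2 * \sum_(k <- simplex d n) Th k t * a k t ^+ 2 + 2 * B / n.+1%:R.
Proof.
move=> t01; have B0 : 0 <= B.
  apply: le_trans (decay i [ffun=> 0%N] t01).
  by rewrite !mulr_ge0 ?ladder_ge0// exprn_ge0// (le_trans _ (one_le_osc_eig R d0 _)).
pose G k := 2 * W k t * a k t * (ladder R (k i) * a (kdec i k) t).
pose H k := 2 * W k t * a k t * (ladder R (k i).+1 * a (kinc i k) t).
have -> : flux n t i = \sum_(k <- simplex d n | (\sum_j k j < n)%N) (G (kinc i k) - H k)
   - \sum_(k <- simplex d n | ~~ (\sum_j k j < n)%N) H k.
  rewrite /flux (eq_bigr (fun k => G k - H k)); last by move=> k _; rewrite /G /H -mulrBr.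
  rewrite sumrB (@sum_simplex_shift _ _ _ i G); last first.
    by move=> k ki; rewrite /G ki ladder0 mul0r mulr0.
  by rewrite [X in _ - X](bigID (fun k : mindex d => \sum_j k j < n)%N)/= opprD addrA -sumrB.
apply: (le_trans (ler_normB _ _)); apply: lerD.
  apply: (@le_trans _ _ (\sum_(k <- simplex d n | (\sum_j k j < n)%N)
     (Th k t * a k t ^+ 2 + Th (kinc i k) t * a (kinc i k) t ^+ 2))).
    apply: (le_trans (ler_norm_sum _ _ _)); apply: ler_sum => k _.
    have -> : G (kinc i k) - H k = ladder R (k i).+1 * (W (kinc i k) t - W k t) *
       (2 * (a k t * a (kinc i k) t)).
      by rewrite /G /H kincK ffunE eqxx addn1; ring.
    rewrite normrM [X in X * _]normrM (ger0_norm (ladder_ge0 _ _)).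
    have := edge i k t01; rewrite le_min => /andP[e1 e2].
    set e := ladder R (k i).+1 * _ in e1 e2 *.
    have e0 : 0 <= e by rewrite mulr_ge0 ?ladder_ge0.
    apply: (@le_trans _ _ (e * (a k t ^+ 2 + a (kinc i k) t ^+ 2))).
      rewrite ler_wpM2l// ler_norml; move: (a k t) (a (kinc i k) t) => u v.
      by have := sqr_ge0 (u + v); have := sqr_ge0 (u - v); nra.
    by rewrite mulrDr lerD// ler_wpM2r// sqr_ge0.
  rewrite big_split/= mulrDl !mul1r; apply: lerD.
    rewrite [leRHS](bigID (fun k : mindex d => \sum_j k j < n)%N)/= lerDl.
    by apply: sumr_ge0 => k _; rewrite mulr_ge0 ?sqr_ge0 ?Th_ge0.
  pose T (k : mindex d) := if k i == 0%N then 0 else Th k t * a k t ^+ 2.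
  rewrite (eq_bigr (fun k => T (kinc i k))); last first.
    by move=> k _; rewrite /T ffunE eqxx addn1.
  rewrite -(@sum_simplex_shift _ _ _ i T); last by move=> k; rewrite /T => ->.
  apply: ler_sum => k _; rewrite /T; case: ifP => // _.
  by rewrite mulr_ge0 ?sqr_ge0 ?Th_ge0.
apply: (le_trans (ler_norm_sum _ _ _)).
apply: (@le_trans _ _ (\sum_(k <- simplex d n | ~~ (\sum_j k j < n)%N)
  (2 * B / n.+1%:R ^+ d.+1))).
  apply: ler_sum => k; rewrite -leqNgt => nk.
  rewrite ler_pdivlMr ?exprn_gt0//.
  apply: (@le_trans _ _ (2 * (W k t * ladder R (k i).+1 *
    (`|a k t| * `|a (kinc i k) t|) * osc_eig R k ^+ d.+1))); last first.
    by rewrite ler_wpM2l// decay.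
  rewrite /H !normrM (ger0_norm (ladder_ge0 _ _)) (ger0_norm (W_ge0 _ _)).
  rewrite (ger0_norm (ler0n _ 2)).
  rewrite [leRHS](_ : _ = 2 * W k t * `|a k t| *
    (ladder R (k i).+1 * `|a (kinc i k) t|) * osc_eig R k ^+ d.+1); last by ring.
  rewrite ler_wpM2l ?mulr_ge0 ?ladder_ge0// lerXn2r ?nnegrE// ?ler0n// ler_nat.
  by move: (\sum_j k j)%N nk d0 => m; lia.
rewrite big_const_seq iter_addr addr0 -[leLHS]mulr_natr.
apply: (@le_trans _ _ (2 * B / n.+1%:R ^+ d.+1 * (n.+1 ^ d)%N%:R)).
  rewrite ler_wpM2l ?divr_ge0 ?mulr_ge0 ?exprn_ge0// ler_nat.
  by rewrite (leq_trans (count_size _ _))// size_simplex.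
by rewrite natrX exprS invfM -!mulrA mulVf ?mulr1// expf_neq0.
Qed.

(** By [dissip], the time derivative of the weight dominates the edge terms, so only
    the flux through |k| = n can increase the truncated energy. *)
Lemma energy_decay n :
  E n 1 <= E n 0 + 2 * (\sum_i `|x 0 i|) * B / n.+1%:R.
Proof.
set X := \sum_i _.
have X0 : 0 <= X by apply: sumr_ge0.
pose da (k : mindex d) t := \sum_i x 0 i *
  (ladder R (k i) * a (kdec i k) t - ladder R (k i).+1 * a (kinc i k) t).
pose dE t := \sum_(k <- simplex d n) (dW k t * a k t ^+ 2 + W k t * (2 * a k t * da k t)).
have DE (t : R) : 0 <= t <= 1 -> is_derive t 1 (E n) (dE t).
  move=> t01; apply: (@is_derive_sum_seq _ _ _ (fun k t => W k t * a k t ^+ 2)) => k.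
  have DWk := DW k t01.
  have Dak := Da k t; rewrite -/(da k t) in Dak.
  by apply: is_derive_eq; rewrite /GRing.scale /=; ring.
have [t t01 EE] := is_derive_MVT ler01 DE.
rewrite -lerBlDl EE subr0 mulr1.
have -> : dE t = \sum_(k <- simplex d n) dW k t * a k t ^+ 2 + \sum_i x 0 i * flux n t i.
  rewrite /dE big_split/=; congr (_ + _).
  under [RHS]eq_bigr do rewrite mulr_sumr.
  rewrite exchange_big /=; apply: eq_bigr => k _.
  rewrite /da !mulr_sumr; apply: eq_bigr => i _; ring.
apply: (@le_trans _ _ (\sum_(k <- simplex d n) dW k t * a k t ^+ 2 +
   X * (2 * \sum_(k <- simplex d n) Th k t * a k t ^+ 2 + 2 * B / n.+1%:R))).
  rewrite lerD2l mulr_suml; apply: ler_sum => i _.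
  rewrite (le_trans (ler_norm _))// normrM ler_wpM2l//.
  exact: flux_le.
rewrite mulrDr addrA [leRHS](_ : _ = 0 + X * (2 * B / n.+1%:R)); last by ring.
rewrite lerD2r mulrA mulr_sumr -big_split/=.
rewrite -[leRHS]oppr0 -[leLHS]opprK lerN2 -sumrN; apply: sumr_ge0 => k _.
rewrite oppr_ge0 (_ : _ + _ = (dW k t + 2 * X * Th k t) * a k t ^+ 2); last by ring.
by rewrite mulr_le0_ge0 ?sqr_ge0//; have := dissip k t01; rewrite -/X; lra.
Qed.

Lemma energy_bound (S : R) (F : seq (mindex d)) : uniq F ->
  (forall n, \sum_(k <- simplex d n) W k 0 * a k 0 ^+ 2 <= S) ->
  \sum_(k <- F) W k 1 * a k 1 ^+ 2 <= S.
Proof.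
move=> uF HS; have [N HN] : exists N, forall k, k \in F -> (\sum_i k i <= N)%N.
  exists (\sum_(k <- F) \sum_i k i)%N => k kF.
  by rewrite (big_rem k)//= leq_addr.
set X := 2 * (\sum_i `|x 0 i|) * B.
apply/ler_addgt0Pr => e e0.
pose n := maxn N (Num.truncn (X / e)).
have HF : \sum_(k <- F) W k 1 * a k 1 ^+ 2 <= E n 1.
  rewrite /E [leRHS](bigID (mem F)) /=; apply: ler_wpDr.
    by apply: sumr_ge0 => k _; rewrite mulr_ge0 ?sqr_ge0.
  rewrite -[leRHS]big_filter le_eqVlt; apply/orP; left; apply/eqP; apply: perm_big.
  apply: uniq_perm => //; first by rewrite filter_uniq// uniq_simplex.
  move=> k; rewrite mem_filter mem_simplex.
  case: (boolP (k \in F)) => //= kF; apply/esym/(leq_trans (HN k kF)).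
  exact: leq_maxl.
apply: (le_trans HF); apply: (le_trans (energy_decay n)). rewrite lerD ?HS//.
rewrite -/X ler_pdivrMr// mulrC -ler_pdivrMr//.
have [X0|X0] := leP 0 (X / e); last by rewrite (le_trans (ltW X0)).
have /andP[_ /ltW h] := Num.Theory.truncn_itv X0.
rewrite (le_trans h)// ler_nat ltnS; exact: leq_maxr.
Qed.

End Energy.

(** * The time-dependent weight *)

Lemma ln_ratio_bound (R : realType) (a b : R) : 0 < a -> a <= 2 * b ->
  `|ln b - ln a| <= 2 * (`|b - a| / a).
Proof.
move=> a0 ab; have b0 : 0 < b by lra.
have key (u v : R) : 0 < u -> 0 < v -> ln v - ln u <= (v - u) / u.
  move=> u0 v0; rewrite -ln_div ?posrE//.
  have -> : v / u = 1 + (v - u) / u by field; rewrite gt_eqF.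
  apply: le_ln1Dx; rewrite -(ltrD2l 1) subrr.
  by rewrite (_ : 1 + (v - u) / u = v / u) ?divr_gt0//; field; rewrite gt_eqF.
have n0 : 0 <= `|b - a| / a by rewrite divr_ge0// ltW.
rewrite ler_norml; apply/andP; split; last first.
  apply: (le_trans (key a b a0 b0)).
  apply: (@le_trans _ _ (`|b - a| / a)); last by lra.
  by rewrite ler_wpM2r ?invr_ge0 ?ler_norm// ltW.
rewrite lerNl opprB; apply: (le_trans (key b a b0 a0)).
apply: (@le_trans _ _ (`|b - a| / b)).
  by rewrite ler_wpM2r ?invr_ge0 ?(ltW b0)// distrC ler_norm.
rewrite mulrCA ler_wpM2l// ler_pdivlMr// mulrC ler_pdivrMr//; lra.
Qed.

Lemma expR_sub1_bound (R : realType) (z : R) : `|expR z - 1| <= `|z| * expR `|z|.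
Proof.
have [z0|/ltW z0] := leP 0 z.
  rewrite !ger0_norm ?subr_ge0// -?expR0 ?ler_expR//.
  have := expR_ge1Dx (- z); have := expR_gt0 z; rewrite expR0 => e0 h.
  have E : expR z * expR (- z) = 1 by rewrite -expRD subrr expR0.
  have : expR z * (1 + - z) <= 1 by rewrite -{2}E ler_wpM2l// ltW.
  lra.
rewrite distrC ger0_norm ?subr_ge0 -?expR0 ?ler_expR//.
rewrite (ler0_norm z0) expR0.
have e1 : 1 <= expR (- z) by rewrite -expR0 ler_expR oppr_ge0.
have := expR_ge1Dx z.
have : - z <= - z * expR (- z) by rewrite ler_peMr// oppr_ge0.
lra.
Qed.

(** (r + s)^al * ((r + g + A) / A)^(-M), written with exponentials so that both
    factors are handled at once. The second factor is a cutoff, equal to 1 in the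
    limit A -> oo. *)
Definition eweight (R : realType) (al : R) (M : nat) (A : R) (s g r : R) : R :=
  expR (al * ln (r + s) - M%:R * ln ((r + g + A) / A)).

(** Minus the logarithmic derivative of [eweight] when s decreases or increases at
    unit speed so that (r + s)^al decreases, and g increases at unit speed. *)
Definition variation_rate (R : realType) (al : R) (M : nat) (A : R) (s g r : R) : R :=
  `|al| / (r + s) + M%:R / (r + g + A).

Definition variation_cst (R : realType) (al : R) : R := 2 * expR (2 * `|al| + 2).

(** ln W varies by at most 2 |r' - r| times [variation_rate], which is at most
    |al| + 1 because M <= A. This hypothesis is what makes [variation_cst]
    independent of M, hence of the distribution under study. *)
Lemma eweight_variation (R : realType) (al : R) (M : nat) (A s g r r' : R) :
  0 <= s -> 0 <= g -> M%:R <= A -> 0 < A -> 1 <= r -> 1 <= r' ->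
  r <= 2 * r' -> `|r' - r| <= 1 ->
  `|eweight al M A s g r' - eweight al M A s g r| <=
  eweight al M A s g r * (variation_cst al * `|r' - r| * variation_rate al M A s g r).
Proof.
move=> s0 g0 MA A0 r1 r1' rr d1.
have rs0 : 0 < r + s by lra.
have rs0' : 0 < r' + s by lra.
have rA0 : 0 < r + g + A by lra.
have rA0' : 0 < r' + g + A by lra.
set Q := variation_rate _ _ _ _ _ _; set W := eweight _ _ _ _ _ r.
have M0 : 0 <= M%:R :> R by [].
have Q1 : Q <= `|al| + 1.
  rewrite /Q /variation_rate; apply: lerD.
    by rewrite ler_pdivrMr// ler_peMr//; lra.
  rewrite ler_pdivrMr//; lra.
have Q0 : 0 <= Q.
  by rewrite /Q /variation_rate addr_ge0 // divr_ge0// ltW.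
pose z := al * (ln (r' + s) - ln (r + s)) - M%:R * (ln (r' + g + A) - ln (r + g + A)).
have -> : eweight al M A s g r' = W * expR z.
  rewrite /W /eweight -expRD; congr expR.
  rewrite !ln_div ?posrE// /z; ring.
have zQ : `|z| <= 2 * (`|r' - r| * Q).
  rewrite /z (le_trans (ler_normB _ _))// !normrM (ger0_norm M0).
  have h1 : `|ln (r' + s) - ln (r + s)| <= 2 * (`|(r' + s) - (r + s)| / (r + s)).
    by apply: ln_ratio_bound => //; lra.
  have h2 : `|ln (r' + g + A) - ln (r + g + A)| <=
     2 * (`|(r' + g + A) - (r + g + A)| / (r + g + A)).
    by apply: ln_ratio_bound => //; lra.
  have e1 : (r' + s) - (r + s) = r' - r by ring.
  have e2 : (r' + g + A) - (r + g + A) = r' - r by ring.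
  rewrite e1 in h1; rewrite e2 in h2.
  apply: (le_trans (lerD (ler_wpM2l (normr_ge0 al) h1) (ler_wpM2l M0 h2))).
  by rewrite /Q /variation_rate le_eqVlt; apply/orP; left; apply/eqP; ring.
have z1 : `|z| <= 2 * `|al| + 2.
  apply: (le_trans zQ); have : `|r' - r| * Q <= 1 * (`|al| + 1) by rewrite ler_pM.
  lra.
rewrite -{2}(mulr1 W) -mulrBr normrM ger0_norm ?expR_ge0// ler_wpM2l ?expR_ge0//.
apply: (le_trans (expR_sub1_bound z)).
apply: (@le_trans _ _ (2 * (`|r' - r| * Q) * expR (2 * `|al| + 2))).
  by apply: ler_pM; rewrite ?expR_ge0 ?ler_expR.
by rewrite /variation_cst le_eqVlt; apply/orP; left; apply/eqP; ring.
Qed.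

Definition osc_rad (R : realType) (d : nat) (k : mindex d) : R := Num.sqrt (osc_eig R k).

Lemma sqr_osc_rad (R : realType) (d : nat) (k : mindex d) : osc_rad R k ^+ 2 = osc_eig R k.
Proof. by rewrite sqr_sqrtr// ler0n. Qed.

Lemma one_le_osc_rad (R : realType) (d : nat) (d0 : (0 < d)%N) (k : mindex d) :
  1 <= osc_rad R k.
Proof. by rewrite -sqrtr1 ler_sqrt ?one_le_osc_eig// ler0n. Qed.

(** r' - r = 2 / (r + r') and sqrt((k_i+1)/2) <= r'/2: the ladder coefficient
    times the step of r stays bounded, which is why translations act at finite
    speed in the variable r. *)
Lemma osc_rad_kinc (R : realType) (d : nat) (i : 'I_d) (k : mindex d)
    (r := osc_rad R k) (r' := osc_rad R (kinc i k)) :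
  [/\ r <= r', r' <= 2 * r, r' - r <= 1 & ladder R (k i).+1 * (r' - r) <= 1].
Proof.
have d0 : (0 < d)%N by exact: leq_ltn_trans (ltn_ord i).
have r1 : 1 <= r by exact: one_le_osc_rad.
have r1' : 1 <= r' by exact: one_le_osc_rad.
have E : r' ^+ 2 = r ^+ 2 + 2 by rewrite !sqr_osc_rad osc_eig_kinc.
have rr : r <= r' by rewrite -(ler_pXn2r (ltn0Sn 1)) ?nnegrE; lra.
have D : (r' - r) * (r' + r) = 2 by rewrite -subr_sqr E; ring.
have r2 : r' <= 2 * r.
  rewrite -(ler_pXn2r (ltn0Sn 1)) ?nnegrE ?mulr_ge0//; try lra.
  by rewrite exprMn; nra.
split => //; first by nra.
have l0 := ladder_ge0 R (k i).+1.
have l2 := sqr_ladder R (k i).+1; rewrite -[(k i).+1%:R]natr1 in l2.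
have := osc_eig_ge R i (kinc i k).
rewrite -sqr_osc_rad -/r' ffunE eqxx addn1 -[(k i).+1%:R]natr1 => h.
have k0 : 0 <= (k i)%:R :> R by [].
have l3 : ladder R (k i).+1 <= r' / 2.
  by rewrite -(ler_pXn2r (ltn0Sn 1)) ?nnegrE// ?divr_ge0//; lra.
apply: (@le_trans _ _ (r' / 2 * (r' - r))); first by rewrite ler_wpM2r ?subr_ge0.
by nra.
Qed.

Lemma expR_natM_ln (R : realType) (n : nat) (y : R) : 0 < y ->
  expR (n%:R * ln y) = y ^+ n.
Proof. by move=> y0; rewrite expRM_natl lnK. Qed.

(** A crude bound, used only to see that large M compensates polynomial growth. *)
Lemma eweight_le (R : realType) (al : R) (n M : nat) (A c s g r : R) :
  `|al| <= n%:R -> 0 < A -> 0 <= s <= c -> 0 <= g -> 1 <= r ->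
  eweight al M A s g r <= ((1 + c) * r) ^+ n * (A / r) ^+ M.
Proof.
move=> aln A0 /andP[s0 sc] g0 r1.
have r0 : 0 < r by lra.
have rs1 : 1 <= r + s by lra.
have rs0 : 0 < r + s by lra.
have cr : r + s <= (1 + c) * r by nra.
have cr0 : 0 < (1 + c) * r by lra.
rewrite -!expR_natM_ln ?divr_gt0// -expRD /eweight ler_expR; apply: lerD.
  apply: (@le_trans _ _ (n%:R * ln (r + s))).
    rewrite ler_wpM2r ?ln_ge0// (le_trans (ler_norm _))//.
  by rewrite ler_wpM2l// ler_ln ?posrE.
rewrite -mulrN ler_wpM2l// -lnV ?posrE ?divr_gt0//; last by lra.
have rg : 0 < r + g + A by lra.
rewrite invf_div ler_ln ?posrE ?divr_gt0// ler_wpM2l ?(ltW A0)//.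
by rewrite lef_pV2 ?posrE//; lra.
Qed.

Lemma is_derive_eweight (R : realType) (al : R) (M : nat) (A s0 s1 c r t : R) :
  al * s1 = - (`|al| * c) -> 0 < r + (s0 + s1 * t) -> 0 < r + c * t + A -> 0 < A ->
  is_derive t 1 (fun t => eweight al M A (s0 + s1 * t) (c * t) r)
   (- (eweight al M A (s0 + s1 * t) (c * t) r *
       (c * variation_rate al M A (s0 + s1 * t) (c * t) r))).
Proof.
move=> als p1 p2 A0.
have D1 : is_derive t 1 (fun t : R => r + (s0 + s1 * t)) s1.
  by apply: is_derive_eq; rewrite /GRing.scale /=; ring.
have D2 : is_derive t 1 (fun t : R => (r + c * t + A) / A) (c / A).
  by apply: is_derive_eq; rewrite /GRing.scale /=; ring.
have p3 : 0 < (r + c * t + A) / A by rewrite divr_gt0.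
have L1 : is_derive t 1 (fun t : R => ln (r + (s0 + s1 * t)))
    ((r + (s0 + s1 * t))^-1 * s1).
  exact: (@is_derive1_comp R (@ln R) (fun t => r + (s0 + s1 * t)) t _ _ (is_derive1_ln p1) D1).
have L2 : is_derive t 1 (fun t : R => ln ((r + c * t + A) / A))
    (((r + c * t + A) / A)^-1 * (c / A)).
  exact: (@is_derive1_comp R (@ln R) (fun t => (r + c * t + A) / A) t _ _
    (is_derive1_ln p3) D2).
have L3 : is_derive t 1
  (fun t : R => al * ln (r + (s0 + s1 * t)) - M%:R * ln ((r + c * t + A) / A))
  (- (c * variation_rate al M A (s0 + s1 * t) (c * t) r)).
  apply: is_derive_eq (is_deriveB (is_deriveZ al L1) (is_deriveZ M%:R L2)) _.
  rewrite /GRing.scale /= /variation_rate.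
  have -> : al * ((r + (s0 + s1 * t))^-1 * s1) = (al * s1) / (r + (s0 + s1 * t)) by ring.
  rewrite als; field.
  by rewrite !gt_eqF.
rewrite -mulrN; exact: (is_derive1_comp (is_derive_expR _) L3).
Qed.

Lemma norm_coord_le_enorm (R : realType) (d : nat) (x : 'rV[R]_d) i : `|x 0 i| <= enorm x.
Proof.
rewrite /enorm -sqrtr_sqr ler_sqrt; last by apply: sumr_ge0 => j _; exact: sqr_ge0.
by rewrite (bigD1 i)//= lerDl; apply: sumr_ge0 => j _; exact: sqr_ge0.
Qed.

(** The speed, per unit length of translation, at which r is shifted in the weight.
    It dominates the 2 d edges at each lattice point. *)
Definition speed (R : realType) (d : nat) (al : R) : R := 2 * d%:R * variation_cst al.

(** * Translation on Hermite-Sobolev spaces *)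

(** [al * s1 = - (|al| c)] expresses that s moves at speed c in the direction in
    which (r + s)^al decreases. M depends on phi, through the growth of its
    coefficients, but c does not. *)
Lemma translate_coef_weighted (R : realType) (d : nat) (d0 : (0 < d)%N) (x : 'rV[R]_d)
    (phi : tempered R d) (al s0 s1 : R) (n : nat) (c := speed d al * enorm x) :
  `|al| <= n%:R -> al * s1 = - (`|al| * c) ->
  (forall t, 0 <= t <= 1 -> 0 <= s0 + s1 * t <= c) ->
  exists M : nat, forall A, 0 < A -> M%:R <= A -> forall S,
    (forall m, \sum_(k <- simplex d m)
       eweight al M A s0 0 (osc_rad R k) * translate_coef x phi k 0 ^+ 2 <= S) ->
    forall F, uniq F ->
    \sum_(k <- F) eweight al M A (s0 + s1) c (osc_rad R k) *
      translate_coef x phi k 1 ^+ 2 <= S.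
Proof.
move=> aln als st.
have [B0 [M0 B0_ge0 HB0]] := translate_coef_growth d0 x phi.
(* One power of the eigenvalue for each of: the weight (n), the ladder
   coefficient (1), the two coefficients (M0 each) and the number of boundary
   points (d + 1). The cutoff exponent is doubled since r^2 is the eigenvalue. *)
pose m := (n + 1 + 2 * M0 + d.+1)%N.
exists (2 * m)%N => A A0 MA S HS F uF.
have ec0 : 0 <= variation_cst al by rewrite mulr_ge0 ?expR_ge0.
have c0 : 0 <= c by rewrite !mulr_ge0 ?sqrtr_ge0.
pose W (k : mindex d) t := eweight al (2 * m) A (s0 + s1 * t) (c * t) (osc_rad R k).
pose Q (k : mindex d) t := variation_rate al (2 * m) A (s0 + s1 * t) (c * t) (osc_rad R k).
have Q_ge0 k t : 0 <= t <= 1 -> 0 <= Q k t.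
  move=> t01; have /andP[st0 _] := st t t01; move: (t01) => /andP[t0 _].
  have ct := mulr_ge0 c0 t0; have r1 := one_le_osc_rad R d0 k.
  by rewrite addr_ge0// divr_ge0//; lra.
have := @energy_bound R d d0 x (translate_coef x phi) W (fun k t => - (W k t * (c * Q k t)))
  (fun k t => W k t * (variation_cst al * Q k t))
  ((1 + c) ^+ n * A ^+ (2 * m) * (B0 ^+ 2 * 3 ^+ M0)).
have E1 : \sum_(k <- F) eweight al (2 * m) A (s0 + s1) c (osc_rad R k) *
     translate_coef x phi k 1 ^+ 2 =
   \sum_(k <- F) W k 1 * translate_coef x phi k 1 ^+ 2.
  by apply: eq_bigr => k _; rewrite /W !mulr1.
rewrite E1; apply => //.
- exact: is_derive_translate_coef.
- move=> k t t01; have /andP[st0 _] := st t t01; move: (t01) => /andP[t0 _].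
  have ct := mulr_ge0 c0 t0; have r1 := one_le_osc_rad R d0 k.
  by apply: is_derive_eweight => //; lra.
- by move=> k t; exact: expR_ge0.
- by move=> k t t01; rewrite mulr_ge0 ?expR_ge0// mulr_ge0// Q_ge0.
- move=> i k t t01; have /andP[st0 _] := st t t01; move: (t01) => /andP[t0 _].
  have ct := mulr_ge0 c0 t0.
  have r1 := one_le_osc_rad R d0 k; have r1' := one_le_osc_rad R d0 (kinc i k).
  have [rr r2 r3 r4] := osc_rad_kinc R i k.
  have l0 := ladder_ge0 R (k i).+1.
  have nr : `|osc_rad R (kinc i k) - osc_rad R k| = osc_rad R (kinc i k) - osc_rad R k.
    by rewrite ger0_norm// subr_ge0.
  have step k1 k2 : 1 <= osc_rad R k1 -> 1 <= osc_rad R k2 ->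
     osc_rad R k1 <= 2 * osc_rad R k2 ->
     `|osc_rad R k2 - osc_rad R k1| = osc_rad R (kinc i k) - osc_rad R k ->
     ladder R (k i).+1 * `|W k2 t - W k1 t| <= W k1 t * (variation_cst al * Q k1 t).
    move=> h1 h2 h12 hE.
    have := @eweight_variation R al (2 * m) A (s0 + s1 * t) (c * t) _ _ st0 ct MA A0 h1 h2 h12.
    rewrite hE => /(_ r3); rewrite -/(W k1 t) -/(W k2 t) -/(Q k1 t) => H.
    apply: (le_trans (ler_wpM2l l0 H)).
    rewrite [leLHS](_ : _ = (ladder R (k i).+1 * (osc_rad R (kinc i k) - osc_rad R k)) *
      (W k1 t * (variation_cst al * Q k1 t))); last by ring.
    by rewrite ler_piMl// mulr_ge0 ?expR_ge0// mulr_ge0// Q_ge0.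
  rewrite le_min; apply/andP; split.
    by apply: step => //; lra.
  by rewrite distrC; apply: step => //; rewrite distrC.
- move=> k t t01; rewrite opprK.
  rewrite [leLHS](_ : _ = W k t *
    ((2 * (\sum_i `|x 0 i|) * variation_cst al) * Q k t)); last by ring.
  rewrite ler_wpM2l ?expR_ge0// ler_wpM2r ?Q_ge0//.
  rewrite /c /speed [leRHS](_ : _ = 2 * (d%:R * enorm x) * variation_cst al); last by ring.
  rewrite ler_wpM2r// ler_wpM2l//.
  apply: (@le_trans _ _ (\sum_(i < d) enorm x)).
    by apply: ler_sum => i _; exact: norm_coord_le_enorm.
  by rewrite sumr_const card_ord mulr_natl.
- move=> i k t t01; have stc := st t t01; move: (t01) => /andP[t0 t1].
  have ct := mulr_ge0 c0 t0; have r1 := one_le_osc_rad R d0 k.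
  have l1 := one_le_osc_eig R d0 k.
  set L := osc_eig R k in l1 *.
  have L0 : 0 < L by lra.
  have tn : `|t| <= 1 by rewrite ger0_norm.
  have rL : osc_rad R k <= L by rewrite /L -sqr_osc_rad; nra.
  have W1 : W k t <= (1 + c) ^+ n * A ^+ (2 * m) * (L ^+ n / L ^+ m).
    have := eweight_le (2 * m) aln A0 stc ct r1; rewrite -/(W k t) => /le_trans; apply.
    rewrite exprMn expr_div_n exprM [osc_rad R k ^+ (2 * m)]exprM sqr_osc_rad -/L -exprM.
    rewrite -!mulrA ler_wpM2l ?exprn_ge0 ?addr_ge0// [leRHS]mulrCA.
    rewrite ler_wpM2r ?mulr_ge0 ?invr_ge0 ?exprn_ge0 ?(ltW A0) ?(ltW L0)//.
    by rewrite lerXn2r ?nnegrE//; lra.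
  have lL : ladder R (k i).+1 <= L.
    have k0 : 0 <= (k i)%:R :> R by [].
    rewrite -[leRHS]ger0_norm ?(ltW L0)// -sqrtr_sqr ler_sqrt ?sqr_ge0//.
    by rewrite -[(k i).+1%:R]natr1; have := osc_eig_ge R i k; rewrite -/L; nra.
  have a1 := HB0 k t tn; have a2 := HB0 (kinc i k) t tn.
  rewrite osc_eig_kinc -/L in a1 a2.
  have a3 : `|translate_coef x phi (kinc i k) t| <= B0 * (3 ^+ M0 * L ^+ M0).
    apply: (le_trans a2); rewrite ler_wpM2l// -exprMn lerXn2r ?nnegrE//; lra.
  apply: (@le_trans _ _ ((1 + c) ^+ n * A ^+ (2 * m) * (L ^+ n / L ^+ m) * L *
     (B0 * L ^+ M0 * (B0 * (3 ^+ M0 * L ^+ M0))) * L ^+ d.+1)).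
    rewrite ler_wpM2r ?exprn_ge0 ?(ltW L0)//.
    apply: ler_pM; rewrite ?mulr_ge0 ?expR_ge0 ?ladder_ge0//.
      by apply: ler_pM; rewrite ?expR_ge0 ?ladder_ge0.
    by apply: ler_pM.
  rewrite le_eqVlt; apply/orP; left; apply/eqP.
  have Lm : L ^+ m = L ^+ n * L * (L ^+ M0 * L ^+ M0) * L ^+ d.+1.
    by rewrite /m mul2n -addnn !exprD expr1.
  rewrite Lm; clear -L0; clearbody L; have L1 : L != 0 by rewrite gt_eqF.
  by field; rewrite !expf_neq0 ?L1.
- by move=> m'; apply: le_trans (HS m'); apply: ler_sum => k _; rewrite /W !mulr0 addr0.
Qed.

Lemma hs_weight_ge0 (R : realType) (d : nat) (p : R) (k : mindex d) : 0 <= hs_weight p k.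
Proof. exact: powR_ge0. Qed.

Lemma hs_weightE (R : realType) (d : nat) (d0 : (0 < d)%N) (p : R) (k : mindex d) :
  hs_weight p k = expR (4 * p * ln (osc_rad R k)).
Proof.
have r1 := one_le_osc_rad R d0 k; have r0 : 0 < osc_rad R k by lra.
rewrite /hs_weight -/(osc_eig R k) -sqr_osc_rad /powR gt_eqF ?exprn_gt0// lnXn//.
by congr expR; rewrite mulr2n; ring.
Qed.

Lemma translate_coef0 (R : realType) (d : nat) (x : 'rV[R]_d) (phi : tempered R d) k :
  translate_coef x phi k 0 = phi (hermite R k).
Proof.
rewrite /translate_coef /translate /=; congr (phi _); apply/val_inj/funext => y /=.
by rewrite /translate_fun scale0r !oppr0 addr0.
Qed.

Lemma translate_coef1 (R : realType) (d : nat) (x : 'rV[R]_d) (phi : tempered R d) k :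
  translate_coef x phi k 1 = translate x phi (hermite R k).
Proof. by rewrite /translate_coef scale1r. Qed.

(** The two choices of s. For p >= 0 the weight starts at (r + c)^(4p) and ends at
    r^(4p); for p < 0 it starts at r^(4p) and ends at (r + c)^(4p). In both cases
    r + c <= (1 + c) r gives the constant (1 + c)^n. *)
Lemma translate_coef_cutoff (R : realType) (d : nat) (d0 : (0 < d)%N) (x : 'rV[R]_d)
    (phi : tempered R d) (p S : R) (n : nat) (c := speed d (4 * p) * enorm x) :
  `|4 * p| <= n%:R ->
  (forall m, \sum_(k <- simplex d m) hs_weight p k * phi (hermite R k) ^+ 2 <= S) ->
  exists M : nat, forall A, 0 < A -> M%:R <= A -> forall F, uniq F ->
  \sum_(k <- F) hs_weight p k * expR (- (M%:R * ln ((osc_rad R k + c + A) / A)))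
     * translate x phi (hermite R k) ^+ 2 <= (1 + c) ^+ n * S.
Proof.
move=> pn HS.
have c0 : 0 <= c by rewrite !mulr_ge0 ?sqrtr_ge0 ?expR_ge0.
have c1 : 0 < 1 + c by lra.
have r1 k := one_le_osc_rad R d0 k.
have lnc : 0 <= ln (1 + c) by rewrite ln_ge0//; lra.
have cut (M : nat) (A s r : R) : 0 < A -> 1 <= r ->
    eweight (4 * p) M A s 0 r <= expR (4 * p * ln (r + s)).
  move=> A0 rr; rewrite /eweight ler_expR gerBl mulr_ge0// ln_ge0//.
  rewrite ler_pdivlMr//; lra.
have lnrc r : 1 <= r -> ln (r + c) <= ln (1 + c) + ln r.
  move=> rr; rewrite -lnM ?posrE//; last by lra.
  by rewrite ler_ln ?posrE ?mulr_gt0//; nra.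
have S0 : 0 <= S.
  apply: le_trans (HS 0%N); apply: sumr_ge0 => k _.
  by rewrite mulr_ge0 ?sqr_ge0 ?hs_weight_ge0.
have [p0|/ltW p0] := leP 0 p.
  have p40 : 0 <= 4 * p by lra.
  have [| |M HM] := @translate_coef_weighted R d d0 x phi (4 * p) c (- c) n pn.
  - by rewrite (ger0_norm p40) mulrN.
  - by move=> t /andP[t0 t1]; rewrite -/c; apply/andP; split; nra.
  exists M => A A0 MA F uF.
  have := HM A A0 MA ((1 + c) ^+ n * S) _ F uF; rewrite subrr => H.
  apply: le_trans (H _); last first.
    move=> m; apply: (@le_trans _ _ (\sum_(k <- simplex d m)
      (1 + c) ^+ n * (hs_weight p k * phi (hermite R k) ^+ 2))); last first.
      by rewrite -mulr_sumr ler_wpM2l// exprn_ge0// ltW.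
    apply: ler_sum => k _; rewrite translate_coef0 mulrA ler_wpM2r ?sqr_ge0//.
    apply: (le_trans (cut _ _ _ _ A0 (r1 k))).
    rewrite (hs_weightE d0) -expR_natM_ln// -expRD ler_expR.
    apply: (le_trans (ler_wpM2l p40 (lnrc _ (r1 k)))).
    rewrite mulrDr lerD2r ler_wpM2r//; apply: le_trans pn; exact: ler_norm.
  apply: ler_sum => k _; rewrite translate_coef1 ler_wpM2r ?sqr_ge0//.
  by rewrite (hs_weightE d0) /eweight -expRD addr0 -/c.
have p40 : 4 * p <= 0 by lra.
have [| |M HM] := @translate_coef_weighted R d d0 x phi (4 * p) 0 c n pn.
- by rewrite (ler0_norm p40); rewrite -/c; ring.
- by move=> t /andP[t0 t1]; rewrite -/c; apply/andP; split; nra.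
exists M => A A0 MA F uF.
have := HM A A0 MA S _ F uF; rewrite add0r => H.
rewrite -ler_pdivrMl ?exprn_gt0// mulr_sumr.
apply: le_trans (H _); last first.
  move=> m; apply: le_trans (HS m); apply: ler_sum => k _.
  rewrite translate_coef0 ler_wpM2r ?sqr_ge0// (le_trans (cut _ _ _ _ A0 (r1 k)))//.
  by rewrite addr0 (hs_weightE d0).
apply: ler_sum => k _; rewrite translate_coef1 mulrA ler_wpM2r ?sqr_ge0//.
rewrite (hs_weightE d0) -expR_natM_ln// -expRN -!expRD /eweight -/c ler_expR.
rewrite addrA lerD2r.
have := ler_wnM2l p40 (lnrc _ (r1 k)); rewrite mulrDr => h.
have : - (4 * p) * ln (1 + c) <= n%:R * ln (1 + c).
  by rewrite ler_wpM2r// (le_trans _ pn)// ler0_norm.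
lra.
Qed.

(** Lets A -> oo in the cutoff, on a finite set of indices: the cutoff is at least
    1 - M (r_k + c) / A. *)
Lemma translate_coef_sum_bound (R : realType) (d : nat) (d0 : (0 < d)%N) (x : 'rV[R]_d)
    (phi : tempered R d) (p S : R) (n : nat) (c := speed d (4 * p) * enorm x) :
  `|4 * p| <= n%:R ->
  (forall m, \sum_(k <- simplex d m) hs_weight p k * phi (hermite R k) ^+ 2 <= S) ->
  forall F, uniq F ->
  \sum_(k <- F) hs_weight p k * translate x phi (hermite R k) ^+ 2 <= (1 + c) ^+ n * S.
Proof.
move=> pn HS F uF; have [M HM] := translate_coef_cutoff d0 x pn HS.
have c0 : 0 <= c by rewrite !mulr_ge0 ?sqrtr_ge0 ?expR_ge0.
rewrite -/c in HM.
pose b k := hs_weight p k * translate x phi (hermite R k) ^+ 2.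
have b0 k : 0 <= b k by rewrite mulr_ge0 ?sqr_ge0 ?hs_weight_ge0.
pose T := \sum_(k <- F) b k * (M%:R * (osc_rad R k + c)).
have T0 : 0 <= T.
  apply: sumr_ge0 => k _; rewrite mulr_ge0// mulr_ge0//.
  by have := one_le_osc_rad R d0 k; lra.
apply/ler_addgt0Pr => e e0.
(* T bounds A times the total loss due to the cutoff. *)
pose A := M%:R + 1 + T / e.
have Te : 0 <= T / e by rewrite divr_ge0// ltW.
have M0 : 0 <= M%:R :> R by [].
have A0 : 0 < A by rewrite /A; lra.
have MA : M%:R <= A by rewrite /A; lra.
have TA : T / A <= e.
  rewrite ler_pdivrMr// mulrC -ler_pdivrMr// /A; lra.
apply: le_trans (lerD (HM A A0 MA F uF) TA).
rewrite /T mulr_suml -big_split /=; apply: ler_sum => k _.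
have r1 := one_le_osc_rad R d0 k.
rewrite mulrAC -/(b k) -mulrA -mulrDr -[leLHS]mulr1 ler_wpM2l//.
have h1 := expR_ge1Dx (- (M%:R * ln ((osc_rad R k + c + A) / A))).
have h2 : ln ((osc_rad R k + c + A) / A) <= (osc_rad R k + c) / A.
  have -> : (osc_rad R k + c + A) / A = 1 + (osc_rad R k + c) / A by field; rewrite gt_eqF.
  by apply: le_ln1Dx; apply: (@lt_le_trans _ _ 0); rewrite ?ltrN10// divr_ge0; lra.
have := ler_wpM2l M0 h2; rewrite mulrA; lra.
Qed.

Lemma hs_sum_translate (R : realType) (d : nat) (d0 : (0 < d)%N) (x : 'rV[R]_d)
    (phi : tempered R d) (p : R) (n : nat) :
  `|4 * p| <= n%:R -> (hs_sum p phi < +oo)%E ->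
  (hs_sum p (translate x phi) <=
    ((1 + speed d (4 * p) * enorm x) ^+ n * fine (hs_sum p phi))%:E)%E.
Proof.
move=> pn fin.
have t0 (u : tempered R d) k : 0 <= hs_weight p k * u (hermite R k) ^+ 2.
  by rewrite mulr_ge0 ?sqr_ge0 ?hs_weight_ge0.
have HS m : \sum_(k <- simplex d m) hs_weight p k * phi (hermite R k) ^+ 2 <=
    fine (hs_sum p phi).
  rewrite -lee_fin fineK; last first.
    by rewrite ge0_fin_numE// esum_ge0// => k _; rewrite lee_fin.
  rewrite -sumEFin esum_ge//; exists [set` simplex d m].
    by split => //; exact: finite_seq.
  by rewrite -fsbig_seq ?uniq_simplex.
apply: ge_ereal_sup => _ [X [finX _] <-].
rewrite fsbig_finite// sumEFin lee_fin.
by have := translate_coef_sum_bound d0 x pn HS; apply; exact: finmap.fset_uniq.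
Qed.

Lemma translate_hs_pred (R : realType) (d : nat) (d0 : (0 < d)%N) (p : R)
    (x : 'rV[R]_d) (phi : hermite_sobolev d p) :
  translate x phi \in @hs_pred R d p.
Proof.
have [n pn] : exists n : nat, `|4 * p| <= n%:R.
  by exists (Num.truncn `|4 * p|).+1; exact/ltW/truncnS_gt.
have := hsP phi; rewrite inE => fin.
by rewrite inE (le_lt_trans (hs_sum_translate d0 x pn fin))// ltry.
Qed.

Definition translate_hs (R : realType) (d : nat) (d0 : (0 < d)%N) (p : R)
    (x : 'rV[R]_d) (phi : hermite_sobolev d p) : hermite_sobolev d p :=
  HermiteSobolev (translate_hs_pred d0 x phi).

Lemma translate_hs_lin (R : realType) (d : nat) (d0 : (0 < d)%N) (p : R)
    (x : 'rV[R]_d) : linear (@translate_hs R d d0 p x).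
Proof.
by move=> a u v; do 2 apply/val_inj.
Qed.

HB.instance Definition _ (R : realType) (d : nat) (d0 : (0 < d)%N) (p : R)
    (x : 'rV[R]_d) :=
  GRing.isLinear.Build R (hermite_sobolev d p) (hermite_sobolev d p) *:%R
    (@translate_hs R d d0 p x) (@translate_hs_lin R d d0 p x).

Theorem theorem2p1 (R : realType) (d : nat) (d_gt0 : (0 < d)%N) (p : R) :
  exists P : {poly R},
    size P = (2 * (Num.truncn `|p|%R + 1)).+1%N /\
    forall x : 'rV[R]_d,
      exists T : {linear hermite_sobolev d p -> hermite_sobolev d p},
        [/\ forall phi, hs_dist (T phi) = translate x phi,
            exists C : R, forall phi, hs_norm (T phi) <= C * hs_norm phi
          & forall phi, hs_norm (T phi) <= P.[enorm x] * hs_norm phi].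
Proof.
set n := (2 * (Num.truncn `|p| + 1))%N.
pose b := speed d (4 * p); have b0 : 0 < b by rewrite !mulr_gt0 ?ltr0n ?expR_gt0.
pose P : {poly R} := (b%:P * 'X + 1%:P) ^+ n.
have PE t : P.[t] = (1 + b * t) ^+ n by rewrite !hornerE /= addrC.
have pn : `|4 * p| <= (n * 2)%:R.
  have h : `|p| <= (Num.truncn `|p|)%:R + 1.
    by have /ltW := truncnS_gt `|p|; rewrite -natr1.
  rewrite normrM (ger0_norm (ler0n _ 4)) /n !natrM natrD; lra.
have bound x (phi : hermite_sobolev d p) :
    hs_norm (translate_hs d_gt0 x phi) <= P.[enorm x] * hs_norm phi.
  have := hsP phi; rewrite inE => fin.
  have le := hs_sum_translate d_gt0 x pn fin.
  have c0 : 0 <= P.[enorm x].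
    by rewrite PE exprn_ge0// addr_ge0// mulr_ge0 ?sqrtr_ge0// ltW.
  have pos (u : tempered R d) : (0 <= hs_sum p u)%E.
    by apply: esum_ge0 => k _; rewrite lee_fin mulr_ge0 ?sqr_ge0 ?hs_weight_ge0.
  rewrite /hs_norm -{1}(ger0_norm c0) -sqrtr_sqr -sqrtrM ?sqr_ge0//.
  rewrite ler_sqrt; last by rewrite mulr_ge0 ?sqr_ge0// fine_ge0.
  rewrite PE -exprM -lee_fin fineK//.
  by rewrite ge0_fin_numE// (le_lt_trans le)// ltry.
exists P; split.
  have s2 : size (b%:P * 'X + 1%:P) = 2%N.
    by rewrite size_MXaddC polyC_eq0 gt_eqF//= size_polyC gt_eqF.
  have P0 : P != 0 by rewrite expf_neq0// -size_poly_eq0 s2.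
  by rewrite -(prednK (_ : 0 < size P)%N) ?size_poly_gt0// size_exp s2 mul1n.
move=> x; exists (translate_hs d_gt0 x); split => //.
  by exists P.[enorm x] => phi; exact: bound.
exact: bound.
Qed.
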